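(* Let $k\ge 3$ be an integer, let $u$ be a real number with $1\le u\le \tfrac12 k(k+1)$, and assume that $\mathrm{MC}_k(u)$ holds. Let $t$ be an integer with $1\le t\le k$, and let $\mathbf i=(i_1,\ldots,i_t)$ be a $t$-tuple of integers with $1\le i_1<i_2<\cdots<i_t\le k$. Let $\iota_1<\cdots<\iota_{k-t}$ be the elements of $\{1,\ldots,k\}\setminus\{i_1,\ldots,i_t\}$, and write $\boldsymbol\alpha^*=(\alpha_{i_1},\ldots,\alpha_{i_t})$ and $\boldsymbol\alpha^\dagger=(\alpha_{\iota_1},\ldots,\alpha_{\iota_{k-t}})$. Then there exists a set $\mathfrak B\subseteq[0,1)^{k-t}$ of full (Lebesgue) measure such that, whenever $\boldsymbol\alpha^\dagger\in\mathfrak B$ and $\varepsilon>0$, then for all real numbers $N$ sufficiently large in terms of $\varepsilon$, $k$ and $\boldsymbol\alpha^\dagger$, one has, for all $\boldsymbol\alpha^*\in[0,1)^t$ and all real $a,b$ with $0\le a<b\le1$, $$|Z_{a,b}(\boldsymbol\alpha;N)-(b-a)N|\le N^{1/2+\nu(\mathbf i)+\varepsilon},$$ where $$\nu(\mathbf i)=\frac{t+2+2(i_1+\cdots+i_t)}{4u+2t+4}.$$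
   Context: For $0\le a<b\le 1$, $\boldsymbol\alpha=(\alpha_1,\ldots,\alpha_k)\in\mathbb R^k$ and real $N>0$, $Z_{a,b}(\boldsymbol\alpha;N)$ denotes the number of integers $n$ with $1\le n\le N$ for which $a\le \alpha_1n+\alpha_2n^2+\cdots+\alpha_kn^k\le b \pmod 1$, i.e. for which there is an integer $m$ with $a\le \alpha_1n+\cdots+\alpha_kn^k-m\le b$. Write $e(z)=e^{2\pi i z}$. For an integer $k\ge 2$, $\boldsymbol\alpha\in\mathbb R^k$ and real $X>0$, put $$f_k(\boldsymbol\alpha;X)=\sum_{1\le x\le X}e(\alpha_1x+\cdots+\alpha_kx^k),$$ the sum being over integers $x$. The assertion $\mathrm{MC}_k(u)$ is that for all real $s$ with $1\le s\le u$ and every $\varepsilon>0$ there is a constant $C=C(k,s,\varepsilon)$ such that for all $X\ge1$, $$\int_{[0,1)^k}|f_k(\boldsymbol\alpha;X)|^{2s}\,d\boldsymbol\alpha\le C X^{\varepsilon}\bigl(X^s+X^{2s-\frac12k(k+1)}\bigr).$$ The point $\boldsymbol\alpha\in[0,1)^k$ is the one assembled from the coordinates in $\boldsymbol\alpha^*$ and $\boldsymbol\alpha^\dagger$. When $t=k$, $[0,1)^{0}$ is a single point of measure $1$. *)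

(* Defs.v *)
From HB Require Import structures.
From mathcomp Require Import all_boot all_order all_algebra.
From mathcomp Require Import complex.
From mathcomp Require Import all_classical all_reals all_analysis.
Import Order.TTheory GRing.Theory Num.Theory.
Import numFieldNormedType.Exports.

Set Implicit Arguments.
Unset Strict Implicit.
Unset Printing Implicit Defensive.

Local Open Scope classical_set_scope.
Local Open Scope ring_scope.

Section lebesgue_cons.
Variables (R : realType) (n : nat).
Notation RT := (measurableTypeR R).
Variable mu : {sigma_finite_measure set (n.-tuple RT) -> \bar R}.

Definition cons_pair (p : RT * n.-tuple RT) : n.+1.-tuple RT :=
  [tuple of p.1 :: p.2].

Definition lebesgue_cons : set (n.+1.-tuple RT) -> \bar R :=
  pushforward (lebesgue_measure \x mu)%E cons_pair.

Let mcons : measurable_fun [set: RT * n.-tuple RT] cons_pair.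
Proof. exact: measurable_cons. Qed.

Let lebesgue_cons0 : lebesgue_cons set0 = 0%E.
Proof. by rewrite /lebesgue_cons /pushforward preimage_set0 measure0. Qed.

Let lebesgue_cons_ge0 A : (0 <= lebesgue_cons A)%E.
Proof. exact: measure_ge0. Qed.

Let lebesgue_cons_sigma_additive : semi_sigma_additive lebesgue_cons.
Proof.
move=> F mF tF mUF; rewrite /lebesgue_cons /pushforward preimage_bigcup.
apply: measure_semi_sigma_additive.
- by move=> i; rewrite -[X in measurable X]setTI; exact: mcons.
- apply/trivIsetP => /= i j _ _ ij; rewrite -preimage_setI.
  by move/trivIsetP : tF => /(_ _ _ _ _ ij) ->//; rewrite preimage_set0.
- by rewrite -preimage_bigcup -[X in measurable X]setTI; exact: mcons.
Qed.

HB.instance Definition _ := isMeasure.Build _ _ _ lebesgue_cons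
  lebesgue_cons0 lebesgue_cons_ge0 lebesgue_cons_sigma_additive.

Let lebesgue_cons_sigma_finite : sigma_finite setT lebesgue_cons.
Proof.
have /sigma_finiteP[F [TF ndF Foo]] := sigma_finiteT (@lebesgue_measure R).
have /sigma_finiteP[G [TG ndG Goo]] := sigma_finiteT mu.
exists (fun i => [set x | F i (tnth x ord0) /\ G i [tuple of behead x]]).
  apply/esym/seteqP; split => // x _.
  have [m _ Fmx] : (\bigcup_m F m) (tnth x ord0) by rewrite -TF.
  have [p _ Gpx] : (\bigcup_m G m) [tuple of behead x] by rewrite -TG.
  exists (maxn m p) => //; split.
  - by move: Fmx; exact/subsetPset/ndF/leq_maxl.
  - by move: Gpx; exact/subsetPset/ndG/leq_maxr.
move=> i; have [mF finF] := Foo i; have [mG finG] := Goo i; split.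
  apply: measurableI; rewrite -[X in measurable X]setTI.
  - exact: measurable_tnth.
  - exact: measurable_behead.
rewrite /lebesgue_cons /pushforward (_ : _ @^-1` _ = F i `*` G i); last first.
  apply/seteqP; split => -[x y] /=.
    by move=> [Fx Gy]; split => //; congr (G i _): Gy; exact/val_inj.
  by move=> [Fx Gy]; split => //; congr (G i _): Gy; exact/val_inj.
by rewrite product_measure1E// lte_mul_pinfty// ge0_fin_numE.
Qed.

HB.instance Definition _ := @Measure_isSigmaFinite.Build _ _ _ lebesgue_cons
  lebesgue_cons_sigma_finite.

End lebesgue_cons.

(* Lebesgue measure on the Borel sets of R^n as an n-fold product; the negligible
   sets are the subsets of Borel null sets, hence all Lebesgue null sets. *)
Fixpoint lebesgue_tuple (R : realType) (n : nat) :
    {sigma_finite_measure set (n.-tuple (measurableTypeR R)) -> \bar R} :=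
  match n with
  | 0 => @dirac _ (0.-tuple (measurableTypeR R)) [tuple] R
  | m.+1 => lebesgue_cons (lebesgue_tuple R m)
  end.

Definition unit_cube (R : realType) (n : nat) : set (n.-tuple (measurableTypeR R)) :=
  [set x | forall j : 'I_n, 0 <= (tnth x j : R) < 1].
Arguments unit_cube : clear implicits.

Section definitions.
Variable R : realType.
Implicit Types (k n t : nat) (a b u X N z : R).

(* alpha_1 x + alpha_2 x ^ 2 + ... + alpha_k x ^ k: tuples are numbered from 0,
   so alpha_j is entry j - 1 *)
Definition phase k (alpha : k.-tuple R) (x : nat) : R :=
  \sum_(j < k) tnth alpha j * x%:R ^+ j.+1.

Definition e2pi z : R[i] := (cos (2 * pi * z) +i* sin (2 * pi * z))%C.

Definition weyl_sum k (alpha : k.-tuple R) X : R[i] :=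
  \sum_(1 <= x < (Num.truncn X).+1) e2pi (phase alpha x).

Definition MC k u : Prop :=
  forall s : R, 1 <= s <= u -> forall eps : R, 0 < eps ->
  exists C : R, forall X : R, 1 <= X ->
    (\int[lebesgue_tuple R k]_(alpha in unit_cube R k)
       ((Normc.normc (weyl_sum alpha X) `^ (2 * s))%:E)
     <= (C * X `^ eps *
         (X `^ s + X `^ (2 * s - k%:R * (k%:R + 1) / 2)))%:E)%E.

Definition Zcount k a b (alpha : k.-tuple R) N : nat :=
  count (fun n => `[< exists m : int, a <= phase alpha n - m%:~R <= b >])
        (iota 1 (Num.truncn N)).

Definition compl_index k (i : seq nat) : seq nat :=
  [seq j <- iota 1 k | j \notin i].

(* The alpha in R^k with alpha_j = astar_l when j = i_l, and alpha_j = adag_l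
   when j = iota_l, iota being compl_index k i; the two defaults 0 of nth are
   not reached when i is strictly increasing with entries in {1, ..., k}. *)
Definition assemble k t (i : t.-tuple nat) (astar : t.-tuple R)
    (adag : (k - t).-tuple R) : k.-tuple R :=
  [tuple if j.+1 \in i then nth 0 astar (index j.+1 i)
         else nth 0 adag (index j.+1 (compl_index k i)) | j < k].

Definition nu t (i : t.-tuple nat) u : R :=
  (t%:R + 2 + 2 * (\sum_(j <- i) j)%N%:R) / (4 * u + 2 * t%:R + 4).

End definitions.

Arguments assemble {R} k {t} i astar adag.

(* Main.v *)
From HB Require Import structures.
Require Import Defs.
From mathcomp Require Import all_boot all_order all_algebra.
From mathcomp Require Import complex zify ring lra.
From mathcomp Require Import all_classical all_reals all_analysis.
From mathcomp Require Import measurable_realfun.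
Import Order.TTheory GRing.Theory Num.Theory.
Import numFieldNormedType.Exports.

Set Implicit Arguments.
Unset Strict Implicit.
Unset Printing Implicit Defensive.

Local Open Scope classical_set_scope.
Local Open Scope ring_scope.

(** Write S y = floor y - y + 1 / 2. The discrepancy is a sum of values of S, and
    the primitive of a Fejer kernel of degree n is a monotone trigonometric
    approximation of floor y + 1 / 2; hence a discrepancy exceeding T at alpha forces
    the weighted sum of (1 / h) |f_k(h alpha'; M)| over h <= n to be at least T / 4, not
    only at alpha' = alpha but at every alpha' whose phases differ from those of alpha
    by at most T / (16 M) for the integers up to M. Those alpha' with the same
    coordinates alpha^dagger contain a box in alpha^* of volume about
    (T / M)^t M^-(i_1 + ... + i_t), so the set of bad alpha^dagger has small measure by
    Fubini, Markov's inequality for the 2u-th moment, and the invariance of the moments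
    under alpha |-> h alpha. For T = M ^ theta the measure is summable over the p-th
    powers M, p being the integer part of 1 / (1 - theta); these powers are dense enough
    for the bound to pass to all N once Borel-Cantelli is applied. *)

(** * The Fejer kernel *)

Section fejer.
Variable R : realType.
Implicit Types (n : nat) (y z w : R).

(** The closed form of the Dirichlet kernel, with its denominator multiplied out so that the zeros
    of [sin (z / 2)] are covered as well. *)
Lemma dirichlet_kernel_sin n z :
  (1 + 2 * \sum_(j < n) cos (j.+1%:R * z)) * sin (z / 2) = sin (n%:R * z + z / 2).
Proof.
elim: n => [|n IHn]; first by rewrite big_ord0 mulr0 addr0 mul1r mul0r add0r.
rewrite big_ord_recr /= mulrDr addrA mulrDl IHn.
have -> : n%:R * z + z / 2 = n.+1%:R * z - z / 2 by rewrite -(natr1 n); field.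
by rewrite !sinD cosN sinN; ring.
Qed.

(** This is [n] times the usual Fejer kernel, the sum of the Dirichlet kernels of degree less than
    [n]. The term [j = n - 1] is 0; it is kept so that all sums run over [j < n]. *)
Definition fejer n z : R :=
  n%:R + 2 * \sum_(j < n) (n%:R - j.+1%:R) * cos (j.+1%:R * z).

Lemma fejerS n z : fejer n.+1 z = fejer n z + (1 + 2 * \sum_(j < n) cos (j.+1%:R * z)).
Proof.
rewrite /fejer big_ord_recr /= subrr mul0r addr0.
have -> : \sum_(j < n) (n.+1%:R - j.+1%:R) * cos (j.+1%:R * z) =
   \sum_(j < n) (n%:R - j.+1%:R) * cos (j.+1%:R * z) + \sum_(j < n) cos (j.+1%:R * z) :> R.
  rewrite -big_split /=; apply: eq_bigr => j _.
  by rewrite -(natr1 n) -(natr1 j); ring.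
by rewrite -(natr1 n); ring.
Qed.

(** By induction: the increment is a Dirichlet kernel, and with [b = z / 2] one has [sin ((n + 1) b)
    ^ 2 - sin (n b) ^ 2 = sin ((2 n + 1) b) sin b]. *)
Lemma fejer_sin n z : fejer n z * sin (z / 2) ^+ 2 = sin (n%:R * (z / 2)) ^+ 2.
Proof.
elim: n => [|n IHn].
  by rewrite /fejer big_ord0 mulr0 addr0 !mul0r sin0 expr0n.
rewrite fejerS mulrDl IHn (expr2 (sin (z / 2))) [X in _ + X]mulrA dirichlet_kernel_sin -(natr1 n).
set a := n%:R * (z / 2); set b := z / 2.
have -> : n%:R * z + b = a + (a + b) by rewrite /a /b; field.
have -> : (n%:R + 1) * b = a + b by rewrite /a /b; ring.
rewrite !sinD cosD.
have := cos2Dsin2 b; set cb := cos b; set sb := sin b => E.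
have {}E : cb ^+ 2 = 1 - sb ^+ 2 by rewrite -E; ring.
transitivity (sin a ^+ 2 * cb ^+ 2 + 2 * sin a * cos a * sb * cb + cos a ^+ 2 * sb ^+ 2); last by ring.
by rewrite E; ring.
Qed.

(** The closed form settles the sign unless [sin (z / 2) = 0]; in that case [cos z = 1] and
    [sin z = 0], so every cosine in the sum equals 1. *)
Lemma fejer_ge0 n z : 0 <= fejer n z.
Proof.
have [s0|s0] := eqVneq (sin (z / 2)) 0; last first.
  have s1 : 0 < sin (z / 2) ^+ 2 by rewrite exprn_even_gt0.
  by rewrite -(pmulr_lge0 _ s1) fejer_sin sqr_ge0.
have zE : z = z / 2 + z / 2 by field.
have c1 : cos z = 1.
  rewrite zE cosD s0 mul0r subr0 -expr2.
  by have := cos2Dsin2 (z / 2); rewrite s0 expr0n addr0.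
have s1 : sin z = 0 by rewrite zE sinD s0 !mul0r mulr0 addr0.
have cj j : cos (j%:R * z) = 1 /\ sin (j%:R * z) = 0.
  elim: j => [|j [IH1 IH2]]; first by rewrite mul0r cos0 sin0.
  by rewrite -(natr1 j) mulrDl mul1r cosD sinD IH1 IH2 c1 s1; split; ring.
rewrite /fejer addr_ge0 // mulr_ge0 // sumr_ge0 // => j _.
by rewrite (cj _).1 mulr1 subr_ge0 ler_nat.
Qed.

Lemma fejer_le n z : sin (z / 2) != 0 -> fejer n z <= (sin (z / 2) ^+ 2)^-1.
Proof.
move=> s0; have s1 : 0 < sin (z / 2) ^+ 2 by rewrite exprn_even_gt0.
rewrite -[leRHS]mul1r ler_pdivlMr // fejer_sin.
by have := cos2Dsin2 (n%:R * (z / 2)); have := sqr_ge0 (cos (n%:R * (z / 2))); lra.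
Qed.

(** The sine coefficients of the primitive of [fejer n (2 * pi * y) / n]. *)
Definition fejer_coef n (j : nat) : R := (1 - j.+1%:R / n%:R) / (pi * j.+1%:R).

(* A trigonometric approximation of the step function y |-> floor y + 1 / 2; its
   derivative is the Fejer kernel, which makes it nondecreasing. *)
Definition smooth_step n y : R :=
  y + \sum_(j < n) fejer_coef n j * sin (2 * pi * (j.+1%:R * y)).

Lemma fejer_coef_ge0 n j : (j < n)%N -> 0 <= fejer_coef n j.
Proof.
move=> jn; have n0 : 0 < n%:R :> R by rewrite ltr0n (leq_ltn_trans _ jn).
rewrite /fejer_coef divr_ge0 ?mulr_ge0 ?pi_ge0 // subr_ge0 ler_pdivrMr // mul1r.
by rewrite ler_nat.
Qed.

Lemma fejer_coef_le n j : fejer_coef n j <= j.+1%:R^-1.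
Proof.
have j0 : 0 < j.+1%:R :> R by rewrite ltr0n.
have p2 : 2 <= pi :> R by exact: pi_ge2.
rewrite /fejer_coef ler_pdivrMr ?mulr_gt0 ?pi_gt0 //.
rewrite mulrCA mulVf ?gt_eqF // mulr1.
have : 0 <= j.+1%:R / n%:R :> R by rewrite divr_ge0.
by lra.
Qed.

Lemma is_derive_smooth_step n y : (0 < n)%N ->
  is_derive y 1 (smooth_step n) (fejer n (2 * pi * y) / n%:R).
Proof.
move=> n0; have nR : n%:R != 0 :> R by rewrite pnatr_eq0 -lt0n.
have d (j : 'I_n) : is_derive y 1
    (fejer_coef n j \*: (sin \o ((2 * pi * j.+1%:R) \*: (@id R))))
    (fejer_coef n j *: (cos (2 * pi * j.+1%:R * y) * (2 * pi * j.+1%:R))).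
  apply: is_deriveZ.
  apply: (@is_derive1_comp _ sin ((2 * pi * j.+1%:R) \*: id) y _ _ (is_derive_sin _)).
  by rewrite -[X in is_derive _ _ _ X]mulr1; exact: is_deriveZ.
have D := is_deriveD (is_derive_id y 1) (is_derive_sum d).
have -> : smooth_step n = id + \sum_(j < n) (fejer_coef n j \*: (sin \o ((2 * pi * j.+1%:R) \*: (@id R)))).
  apply/funext => x; rewrite /smooth_step /= [RHS]/GRing.add /= fct_sumE.
  by congr (_ + _); apply: eq_bigr => j _ /=; rewrite /GRing.scale /= !mulrA.
suff <- : 1 + \sum_(j < n) fejer_coef n j *: (cos (2 * pi * j.+1%:R * y) * (2 * pi * j.+1%:R)) =
  fejer n (2 * pi * y) / n%:R by exact: D.
rewrite /fejer [RHS]mulrDl divff //; congr (_ + _).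
rewrite mulr_sumr mulr_suml; apply: eq_bigr => j _.
rewrite /fejer_coef /GRing.scale /=.
have -> : 2 * pi * j.+1%:R * y = j.+1%:R * (2 * pi * y) by ring.
have jR : j.+1%:R != 0 :> R by rewrite pnatr_eq0.
have pR : pi != 0 :> R by rewrite gt_eqF // pi_gt0.
move: (cos _) => C; clear d D; move: nR jR pR.
move: (n%:R : R) (j.+1%:R : R) (pi : R) => N J P nR jR pR.
by field; rewrite nR jR pR.
Qed.

Lemma smooth_step_ndecr n y z : (0 < n)%N -> y <= z -> smooth_step n y <= smooth_step n z.
Proof.
move=> n0 yz.
have dr x : x \in `]y, z[ -> is_derive x 1 (smooth_step n) (fejer n (2 * pi * x) / n%:R).
  by move=> _; exact: is_derive_smooth_step.
have [|c _ E] := MVT_segment yz dr.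
  apply: continuous_subspaceT => x; apply: differentiable_continuous.
  by apply/derivable1_diffP; have [] := is_derive_smooth_step x n0.
by rewrite -subr_ge0 E mulr_ge0 ?subr_ge0 // divr_ge0 // fejer_ge0.
Qed.

Lemma sin_2pi_nat (m : nat) y : sin (2 * pi * (y + m%:R)) = sin (2 * pi * y).
Proof.
elim: m => [|m IH]; first by rewrite addr0.
have -> : 2 * pi * (y + m.+1%:R) = 2 * pi * (y + m%:R) + pi *+ 2.
  by rewrite -(natr1 m) -mulr_natr; ring.
by rewrite sinD2pi.
Qed.

Lemma cos_2pi_nat (m : nat) y : cos (2 * pi * (y + m%:R)) = cos (2 * pi * y).
Proof.
elim: m => [|m IH]; first by rewrite addr0.
have -> : 2 * pi * (y + m.+1%:R) = 2 * pi * (y + m%:R) + pi *+ 2.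
  by rewrite -(natr1 m) -mulr_natr; ring.
by rewrite cosD2pi.
Qed.

Lemma smooth_stepDn n y (m : nat) : smooth_step n (y + m%:R) = smooth_step n y + m%:R.
Proof.
rewrite /smooth_step addrAC; congr (_ + _ + _); apply: eq_bigr => j _.
by rewrite [j.+1%:R * (_ + _)]mulrDr -natrM sin_2pi_nat.
Qed.

Lemma smooth_stepN n y : smooth_step n (- y) = - smooth_step n y.
Proof.
rewrite /smooth_step opprD -sumrN; congr (_ + _); apply: eq_bigr => j _.
by rewrite !mulrN sinN mulrN.
Qed.

Lemma smooth_stepDz n y (m : int) : smooth_step n (y + m%:~R) = smooth_step n y + m%:~R.
Proof.
case: m => m; first exact: smooth_stepDn.
rewrite NegzE mulrNz; apply: (addIr (m.+1%:~R : R)); rewrite subrK.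
by rewrite -[X in _ + X]/(m.+1%:R : R) -smooth_stepDn -pmulrn subrK.
Qed.

Lemma smooth_step_half n : smooth_step n (1 / 2) = 1 / 2.
Proof.
rewrite /smooth_step big1 ?addr0 // => j _.
suff -> : sin (2 * pi * (j.+1%:R * (1 / 2))) = 0 :> R by rewrite mulr0.
have -> : 2 * pi * (j.+1%:R * (1 / 2)) = pi * j.+1%:R :> R by field.
elim: (j.+1) => [|m IH]; first by rewrite mulr0 sin0.
by rewrite -(natr1 m) mulrDr mulr1 sinDpi IH oppr0.
Qed.

Lemma sin_le_id y : 0 <= y -> sin y <= y.
Proof.
move=> y0; have [|c _] := MVT_segment (f := sin) (df := cos) y0 (fun x _ => is_derive_sin x).
  by apply: continuous_subspaceT => x; exact: continuous_sin.
by rewrite sin0 !subr0 => ->; rewrite ler_piMl // cos_le1.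
Qed.

Lemma cos_ge_half y : 0 <= y <= 1 -> 1 / 2 <= cos y.
Proof.
move=> /andP[y0 y1].
have yE : y = y / 2 + y / 2 by field.
have s1 : sin (y / 2) <= 1 / 2 by apply: (le_trans (sin_le_id _)); lra.
have s0 : 0 <= sin (y / 2) by apply: sin_ge0_pi; have := @pi_ge2 R; lra.
rewrite yE cosD.
by have := cos2Dsin2 (y / 2); nra.
Qed.

Lemma half_le_sin y : 0 <= y <= 1 -> y / 2 <= sin y.
Proof.
move=> /andP[y0 y1]; have [|c] := MVT_segment (f := sin) (df := cos) y0 (fun x _ => is_derive_sin x).
  by apply: continuous_subspaceT => x; exact: continuous_sin.
rewrite in_itv /= => /andP[c0 c1]; rewrite sin0 !subr0 => ->.
have : 1 / 2 <= cos c by apply: cos_ge_half; rewrite c0 (le_trans c1).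
by nra.
Qed.

(** The value at [1 / 2] is exact, and on [[w, 1 / 2]] the derivative is at most
    [1 / (n sin (pi c) ^ 2) <= 1 / (n w ^ 2)]; the mean value theorem gives the rest. *)
Lemma smooth_step_near_half n w : (0 < n)%N -> 0 < w <= 1 / 8 ->
  1 / 2 - (n%:R * w ^+ 2)^-1 <= smooth_step n w.
Proof.
move=> n0 /andP[w0 w1].
have w2 : w <= 1 / 2 by lra.
have [|c] := MVT_segment w2 (fun x _ => is_derive_smooth_step x n0).
  apply: continuous_subspaceT => x; apply: differentiable_continuous.
  by apply/derivable1_diffP; have [] := is_derive_smooth_step x n0.
rewrite in_itv /= => /andP[c0 c1]; rewrite smooth_step_half => E.
have p0 := @pi_gt0 R.
have s1 : w <= sin (pi * c).
  have [cw|cw] := leP (pi * c) 1.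
    apply: le_trans (half_le_sin _); last by rewrite cw mulr_ge0 // ltW // (lt_le_trans w0).
    by have := @pi_ge2 R; nra.
  (* Here [pi * c > 1], and doubling the angle gives [sin (pi * c) >= pi * c / 4 > 1 / 4], which
     exceeds [w]. *)
  have := half_le_sin (y := pi * c / 2); have := cos_ge_half (y := pi * c / 2).
  have pi4 : pi <= 4 :> R by by have /andP[_] := pihalf_02 R; lra.
  have y01 : 0 <= pi * c / 2 <= 1 by apply/andP; split; nra.
  move=> /(_ y01) h1 /(_ y01) h2.
  have -> : pi * c = pi * c / 2 + pi * c / 2 by field.
  by rewrite sinD; nra.
have Ec : 2 * pi * c / 2 = pi * c by field.
have s0 : 0 < sin (pi * c) by exact: lt_le_trans s1.
have nR : 0 < n%:R :> R by rewrite ltr0n.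
have F : fejer n (2 * pi * c) <= (w ^+ 2)^-1.
  apply: le_trans (fejer_le _ _) _; rewrite Ec ?gt_eqF // lef_pV2 ?posrE ?exprn_gt0 //.
  by rewrite ler_pXn2r // nnegrE ltW.
suff : 1 / 2 - smooth_step n w <= (n%:R * w ^+ 2)^-1 by lra.
rewrite E invfM [leLHS]mulrAC [leRHS]mulrC ler_pM2r ?invr_gt0 //.
by have := fejer_ge0 n (2 * pi * c); nra.
Qed.

Lemma smooth_stepB n y : smooth_step n (1 - y) = 1 - smooth_step n y.
Proof. by rewrite addrC -[X in _ + X]/(1%:R : R) smooth_stepDn smooth_stepN addrC. Qed.

End fejer.

(** * A perturbed Erdos-Turan inequality *)

Section erdos_turan.
Variable R : realType.
Implicit Types (a b y w tau eta c : R) (n M : nat) (x : nat -> R).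

(** Once the integer part is removed, the shift puts the argument at or beyond [w], so monotonicity
    reduces the claim to the value at [w]. *)
Lemma floor_le_smooth_step n w y : (0 < n)%N -> 0 < w <= 1 / 8 ->
  (Num.floor y)%:~R <= smooth_step n (y + w) - 1 / 2 + (n%:R * w ^+ 2)^-1.
Proof.
move=> n0 w01; have /andP[fl _] := floor_itv y.
have -> : y + w = (y - (Num.floor y)%:~R + w) + (Num.floor y)%:~R by ring.
rewrite smooth_stepDz; have := smooth_step_near_half n0 w01.
have : smooth_step n w <= smooth_step n (y - (Num.floor y)%:~R + w).
  by apply: smooth_step_ndecr => //; lra.
by lra.
Qed.

(** The mirror image of the upper bound: the shifted fractional part stays below [1 - w], where the
    reflection [smooth_stepB] applies. *)
Lemma smooth_step_le_floor n w y : (0 < n)%N -> 0 < w <= 1 / 8 ->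
  smooth_step n (y - w) - 1 / 2 - (n%:R * w ^+ 2)^-1 <= (Num.floor y)%:~R.
Proof.
move=> n0 w01; have /andP[_] := floor_itv y; rewrite intrD => fl.
have -> : y - w = (y - (Num.floor y)%:~R - w) + (Num.floor y)%:~R by ring.
rewrite smooth_stepDz; have := smooth_step_near_half n0 w01.
have : smooth_step n (y - (Num.floor y)%:~R - w) <= smooth_step n (1 - w).
  by apply: smooth_step_ndecr => //; lra.
by rewrite smooth_stepB; lra.
Qed.

Definition sawtooth y : R := (Num.floor y)%:~R - y + 1 / 2.

Definition harmonic_exp_sum n M x : R :=
  \sum_(h < n) h.+1%:R^-1 * Normc.normc (\sum_(1 <= m < M.+1) e2pi (h.+1%:R * x m)).

Lemma sum_e2pi M (z : nat -> R) : \sum_(1 <= m < M.+1) e2pi (z m) =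
  ((\sum_(1 <= m < M.+1) cos (2 * pi * z m)) +i* (\sum_(1 <= m < M.+1) sin (2 * pi * z m)))%C.
Proof. by elim/big_rec3: _ => // m u v w _ ->. Qed.

(** The shift [c] multiplies the exponential sum by a number of modulus 1. In real terms this is the
    Cauchy-Schwarz inequality for the pair of sums and the pair [cos (2 * pi * c)],
    [sin (2 * pi * c)]. *)
Lemma sin_sum_le M x c : `|\sum_(1 <= m < M.+1) sin (2 * pi * (x m + c))| <=
  Normc.normc (\sum_(1 <= m < M.+1) e2pi (x m)).
Proof.
rewrite sum_e2pi /=; set C := \sum_(1 <= m < M.+1) cos _; set S := \sum_(1 <= m < M.+1) sin (2 * pi * x m).
have -> : \sum_(1 <= m < M.+1) sin (2 * pi * (x m + c)) =
   S * cos (2 * pi * c) + C * sin (2 * pi * c).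
  rewrite /S /C !mulr_suml -big_split /=; apply: eq_bigr => m _.
  by rewrite mulrDr sinD.
rewrite -sqrtr_sqr ler_wsqrtr //.
have := cos2Dsin2 (2 * pi * c); have := sqr_ge0 (C * cos (2 * pi * c) - S * sin (2 * pi * c)).
set p := cos (2 * pi * c); set q := sin (2 * pi * c) => h1 h2.
have -> : C ^+ 2 + S ^+ 2 = (C ^+ 2 + S ^+ 2) * (p ^+ 2 + q ^+ 2) by rewrite h2 mulr1.
rewrite -subr_ge0; move: h1; congr (0 <= _); ring.
Qed.

(** The bound is uniform in [c], so that points may later be shifted at no cost in the exponential
    sums. *)
Lemma sum_smooth_step_le n M x c :
  `|\sum_(1 <= m < M.+1) (smooth_step n (x m + c) - (x m + c))| <= harmonic_exp_sum n M x.
Proof.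
rewrite /smooth_step; under eq_bigr do rewrite addrC addKr.
rewrite exchange_big /=; apply: le_trans (ler_norm_sum _ _ _) _; apply: ler_sum => h _.
rewrite -mulr_sumr normrM; apply: ler_pM => //.
  by rewrite ger0_norm ?fejer_coef_le // fejer_coef_ge0.
have hD m : h.+1%:R * (x m + c) = h.+1%:R * x m + h.+1%:R * c by rewrite mulrDr.
under eq_bigr do rewrite hD.
exact: (sin_sum_le M (fun m => h.+1%:R * x m)).
Qed.

(* The monotonicity of [smooth_step] is what allows the points [x m] to be moved by [eta]. *)
Lemma sum_sawtooth_le n M x x' c w eta : (0 < n)%N -> 0 < w <= 1 / 8 -> 
  (forall m, (1 <= m <= M)%N -> `|x' m - x m| <= eta) ->
  `|\sum_(1 <= m < M.+1) sawtooth (x m + c)| <=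
    M%:R * (w + 2 * eta + (n%:R * w ^+ 2)^-1) + harmonic_exp_sum n M x'.
Proof.
move=> n0 w01 xx'; set tau := (n%:R * w ^+ 2)^-1.
have E (r : R) : M%:R * r = \sum_(1 <= m < M.+1) r.
  by rewrite big_const_nat iter_addr addr0 subn1 /= mulr_natl.
rewrite ler_norml; apply/andP; split; last first.
  (* The shift [w] serves the approximation of the floor, and [eta] allows for [x' m] lying below
     [x m]. Comparing the linear terms costs [w + eta] for the shift and another [eta] for
     [x' m - x m]. *)
  have := sum_smooth_step_le n M x' (w + eta + c); rewrite ler_norml => /andP[_ H].
  apply: le_trans (lerD (lexx _) H); rewrite E -big_split /=.
  rewrite big_nat_cond [leRHS]big_nat_cond; apply: ler_sum => m /andP[]; rewrite ltnS => mM _.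
  have := xx' _ mM; rewrite ler_norml => /andP[h1 h2].
  have := floor_le_smooth_step (x m + c) n0 w01; rewrite -/tau /sawtooth.
  have : smooth_step n (x m + c + w) <= smooth_step n (x' m + (w + eta + c)).
    by apply: smooth_step_ndecr => //; lra.
  by lra.
have := sum_smooth_step_le n M x' (c - w - eta); rewrite ler_norml => /andP[H _].
rewrite opprD; apply: le_trans (lerD (lexx _) H) _; rewrite E -sumrN -big_split /=.
rewrite big_nat_cond [leRHS]big_nat_cond; apply: ler_sum => m /andP[]; rewrite ltnS => mM _.
have := xx' _ mM; rewrite ler_norml => /andP[h1 h2].
have := smooth_step_le_floor (x m + c) n0 w01; rewrite -/tau /sawtooth.
have : smooth_step n (x' m + (c - w - eta)) <= smooth_step n (x m + c - w).
  by apply: smooth_step_ndecr => //; lra.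
by lra.
Qed.

(** A change of sign conjugates the exponential sums and keeps their moduli. *)
Lemma harmonic_exp_sumN n M x :
  harmonic_exp_sum n M (fun m => - x m) = harmonic_exp_sum n M x.
Proof.
apply: eq_bigr => h _; congr (_ * _).
rewrite !sum_e2pi /=; congr (Num.sqrt (_ + _)).
  by congr (_ ^+ 2); apply: eq_bigr => m _; rewrite !mulrN cosN.
by rewrite -sqrrN -sumrN; congr (_ ^+ 2); apply: eq_bigr => m _; rewrite !mulrN sinN opprK.
Qed.

(** The arguments [y - a] and [b - y] add up to [b - a], so their floors add up to 0 or -1. The sum
    is 0 exactly when some integer [m] has [m <= y - a] and [- m <= b - y]; taking the floor of
    [b - y] keeps the interval closed at both ends. *)
Lemma Zmod_count y a b : a < b -> b - a < 1 ->
  `[< exists m : int, a <= y - m%:~R <= b >]%:R =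
    sawtooth (y - a) + sawtooth (b - y) + (b - a) :> R.
Proof.
move=> ab ba; rewrite /sawtooth.
have /andP[p1 p2] := floor_itv (y - a); have /andP[q1 q2] := floor_itv (b - y).
move: p1 p2 q1 q2; set p := Num.floor (y - a); set q := Num.floor (b - y).
rewrite !intrD => p1 p2 q1 q2.
suff : (`[< exists m : int, a <= y - m%:~R <= b >]%:R : R) = p%:~R + q%:~R + 1 by move=> ->; field.
have [m1|m1] := leP 0 (p + q).
  have pq0 : p + q = 0.
    apply/eqP; rewrite eq_le m1 andbT; rewrite -ltzD1 -(ltr_int R) !intrD.
    by lra.
  have pq : (p%:~R + q%:~R : R) = 0 by rewrite -intrD pq0.
  rewrite pq add0r; suff -> : `[< exists m : int, a <= y - m%:~R <= b >] = true by [].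
  apply/asboolP; exists p; apply/andP; split; lra.
have pq0 : p + q = -1.
  apply/eqP; rewrite eq_le; apply/andP; split; first by rewrite -ltzD1 addNr.
  rewrite -ltzD1 -(ltr_int R) !intrD; lra.
have pq : (p%:~R + q%:~R : R) = -1 by rewrite -intrD pq0.
rewrite pq addNr; suff -> : `[< exists m : int, a <= y - m%:~R <= b >] = false by [].
apply/negbTE/negP => /asboolP[m /andP[m2 m3]].
have h1 : m <= p by rewrite -ltzD1 -(ltr_int R) intrD; lra.
have h2 : - m <= q by rewrite -ltzD1 -(ltr_int R) intrD mulrNz; lra.
have : 0 <= p + q by rewrite -(subrr m) lerD.
by rewrite pq0.
Qed.

Lemma ZcountE k a b (alpha : k.-tuple R) M :
  (Zcount a b alpha M%:R)%:R =
  \sum_(1 <= m < M.+1) `[< exists r : int, a <= phase alpha m - r%:~R <= b >]%:R :> R.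
Proof.
by rewrite /Zcount natrK -sum1_count /index_iota subn1 /= natr_sum [RHS]big_mkcond /= [LHS]big_mkcond;
  apply: eq_bigr => m _; case: ifP.
Qed.

(** The full interval, which the condition [b - a < 1] of [Zmod_count] excludes. *)
Lemma Zcount01 k (alpha : k.-tuple R) M : Zcount 0 1 alpha M%:R = M.
Proof.
rewrite /Zcount natrK -[RHS](size_iota 1); apply/eqP; rewrite -all_count; apply/allP => m _.
apply/asboolP; exists (Num.floor (phase alpha m)).
by have /andP[] := floor_itv (phase alpha m); rewrite intrD => h1 h2; apply/andP; split; lra.
Qed.

Lemma normc_ge0 (z : R[i]) : 0 <= Normc.normc z.
Proof. by case: z => p q; exact: sqrtr_ge0. Qed.

Lemma harmonic_exp_sum_ge0 n M x : 0 <= harmonic_exp_sum n M x.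
Proof. by apply: sumr_ge0 => h _; rewrite mulr_ge0 ?invr_ge0 ?ler0n // normc_ge0. Qed.

(** Two sawtooth sums occur, one along the phases and one along their negatives, whence the factor
    2. The discrepancy is that of [alpha], while the exponential sums are those of the neighbour
    [alpha']. *)
Lemma Zcount_discrepancy k (alpha alpha' : k.-tuple R) n M a b w eta :
  (0 < n)%N -> 0 < w <= 1 / 8 -> 0 <= eta -> 0 <= a -> a < b -> b <= 1 ->
  (forall m, (1 <= m <= M)%N -> `|phase alpha' m - phase alpha m| <= eta) ->
  `|(Zcount a b alpha M%:R)%:R - (b - a) * M%:R| <=
  2 * (M%:R * (w + 2 * eta + (n%:R * w ^+ 2)^-1) + harmonic_exp_sum n M (phase alpha')).
Proof.
move=> n0 w01 eta0 a0 ab b1 close.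
have [ba|ba] := ltP (b - a) 1; last first.
  have -> : a = 0 by lra.
  have -> : b = 1 by lra.
  rewrite Zcount01 subr0 mul1r subrr normr0.
  rewrite mulr_ge0 // addr_ge0 ?harmonic_exp_sum_ge0 // mulr_ge0 //.
  have /andP[w0 _] := w01; rewrite !addr_ge0 ?mulr_ge0 ?invr_ge0 ?mulr_ge0 ?sqr_ge0 //; exact: ltW.
rewrite ZcountE (eq_bigr _ (fun m _ => Zmod_count _ ab ba)).
rewrite big_split /= big_const_nat iter_addr addr0 subn1 /= -[_ *+ M]mulr_natr addrK.
have H1 := sum_sawtooth_le (- a) n0 w01 close.
have closeN m : (1 <= m <= M)%N -> `|- phase alpha' m - - phase alpha m| <= eta.
  by move=> mM; rewrite -opprD normrN close.
have := sum_sawtooth_le (x := fun m => - phase alpha m) (x' := fun m => - phase alpha' m) b n0 w01 closeN.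
rewrite harmonic_exp_sumN => H2.
rewrite mulr2n mulrDl mul1r big_split /=; apply: le_trans (ler_normD _ _) (lerD _ _) => //.
by under eq_bigr do rewrite addrC.
Qed.

End erdos_turan.

(** * Iterated integrals over tuples *)

Section tuple_integral.
Variable R : realType.
Notation RT := (measurableTypeR R).
Notation mu := (@lebesgue_measure R).
Notation lam := (lebesgue_tuple R).
Implicit Types (k n t r : nat).

Lemma measurable_cons_pair n : measurable_fun setT (@cons_pair R n).
Proof. exact: measurable_cons. Qed.

Lemma measurable_cons_pairr n (x : RT) :
  measurable_fun setT (fun y : n.-tuple RT => cons_pair (x, y)).
Proof. exact: (measurable_cons (f := fun=> x) (g := id)). Qed.

Lemma integral_cons n (F : n.+1.-tuple RT -> \bar R) :
  measurable_fun [set: n.+1.-tuple RT] F -> (forall x, 0 <= F x)%E ->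
  (\int[lam n.+1]_x F x = \int[mu]_x \int[lam n]_y F (cons_pair (x, y)))%E.
Proof.
move=> mF F0.
transitivity (\int[mu \x lam n]_z F (cons_pair z))%E; last first.
  rewrite (@fubini_tonelli1 _ _ _ _ _ mu (lam n) (F \o (@cons_pair R n))) //.
    by apply: measurableT_comp mF _; exact: measurable_cons_pair.
  by move=> x; exact: F0.
have := @ge0_integral_pushforward _ _ _ _ R _ (@measurable_cons_pair n)
   (mu \x lam n)%E setT F measurableT mF (fun y _ => F0 y).
by rewrite preimage_setT => <-.
Qed.

Lemma behead_cons_pair n (x : RT) (s : n.-tuple RT) : [tuple of behead (cons_pair (x, s))] = s.
Proof. exact: val_inj. Qed.

Lemma thead_cons_pair n (x : RT) (s : n.-tuple RT) : thead (cons_pair (x, s)) = x.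
Proof. by []. Qed.

Lemma measurable_thead n : measurable_fun setT (fun x : n.+1.-tuple RT => thead x).
Proof. exact: measurable_tnth. Qed.

(** The order-preserving ways to merge a [t]-tuple and an [r]-tuple into a [k]-tuple. Built one head
    coordinate at a time, they match the recursive product measure, so Tonelli can be applied by
    induction without permuting coordinates. *)
Inductive interleave : forall k t r, (t.-tuple RT -> r.-tuple RT -> k.-tuple RT) -> Prop :=
| interleave_nil : @interleave 0 0 0 (fun _ _ => [tuple])
| interleave_left k t r g of @interleave k t r g :
   @interleave k.+1 t.+1 r (fun s d => cons_pair (thead s, g [tuple of behead s] d))
| interleave_right k t r g of @interleave k t r g :
   @interleave k.+1 t r.+1 (fun s d => cons_pair (thead d, g s [tuple of behead d])).

Lemma measurable_interleave k t r g : @interleave k t r g ->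
  measurable_fun setT (fun p : r.-tuple RT * t.-tuple RT => g p.2 p.1).
Proof.
elim => {k t r g} [|k t r g _ IH|k t r g _ IH]; first exact: measurable_cst.
- apply: measurable_cons; first exact: measurableT_comp (@measurable_thead _) _.
  apply: (measurableT_comp (f := fun p => g p.2 p.1) (g := fun p : r.-tuple RT * t.+1.-tuple RT => (p.1, [tuple of behead p.2]))) => //.
  apply: measurable_fun_pair; first exact: measurable_fst.
  exact: (measurableT_comp (@measurable_behead _ _ _) measurable_snd).
- apply: measurable_cons; first exact: measurableT_comp (@measurable_thead _) _.
  apply: (measurableT_comp (f := fun p => g p.2 p.1) (g := fun p : r.+1.-tuple RT * t.-tuple RT => ([tuple of behead p.1], p.2))) => //.
  apply: measurable_fun_pair; last exact: measurable_snd.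
  exact: (measurableT_comp (@measurable_behead _ _ _) measurable_fst).
Qed.

(** If the head coordinate belongs to [s], its integral stands outside the one over [d] and Tonelli
    moves it inside; if it belongs to [d], the order is already right. *)
Lemma integral_interleave k t r g (F : k.-tuple RT -> \bar R) : @interleave k t r g ->
  measurable_fun [set: k.-tuple RT] F -> (forall x, 0 <= F x)%E ->
  (\int[lam k]_x F x = \int[lam r]_d \int[lam t]_s F (g s d))%E.
Proof.
move=> G; elim: G F => {k t r g} [|k t r g G IH|k t r g G IH] F mF F0.
- by rewrite /= !integral_dirac // !diracT !mul1e; congr F; exact: val_inj.
- rewrite integral_cons //.
  have mFg : measurable_fun setT (fun p : (RT * r.-tuple RT) * t.-tuple RT => F (cons_pair (p.1.1, g p.2 p.1.2))).
    apply: measurableT_comp mF _; apply: measurable_cons.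
      exact: (measurableT_comp measurable_fst measurable_fst).
    apply: (measurableT_comp (measurable_interleave G) (g := fun p => (p.1.2, p.2))).
    apply: measurable_fun_pair; last exact: measurable_snd.
    exact: (measurableT_comp measurable_snd measurable_fst).
  transitivity (\int[mu]_x \int[lam r]_d \int[lam t]_s F (cons_pair (x, g s d)))%E.
    apply: eq_integral => x _; rewrite IH //.
    by apply: measurableT_comp mF _; exact: measurable_cons_pairr.
  pose H (p : RT * r.-tuple RT) : \bar R := (\int[lam t]_s F (cons_pair (p.1, g s p.2)))%E.
  have mH : measurable_fun setT H.
    have -> : H = fubini_F (lam t) (fun p => F (cons_pair (p.1.1, g p.2 p.1.2))) by [].
    apply: measurable_fun_fubini_tonelli_F mFg _ => p; exact: F0.
  rewrite (@fubini_tonelli _ _ _ _ _ mu (lam r) H) //; last by move=> x; exact: integral_ge0.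
  apply: eq_integral => d _; rewrite integral_cons //.
  + apply: eq_integral => x _; apply: eq_integral => s _.
    by rewrite behead_cons_pair thead_cons_pair.
  + apply: measurableT_comp mF _.
    have := measurable_interleave (interleave_left G).
    move=> mg; apply: (measurableT_comp mg (g := fun s => (d, s))).
    by apply: measurable_fun_pair => //; exact: measurable_cst.
- rewrite integral_cons //.
  have mFg : measurable_fun setT (fun p : r.+1.-tuple RT * t.-tuple RT => 
      F (cons_pair (thead p.1, g p.2 [tuple of behead p.1]))).
    by apply: measurableT_comp mF _; exact: measurable_interleave (interleave_right G).
  rewrite [RHS]integral_cons //; last 2 first.
  + rewrite [X in measurable_fun _ X](_ : _ = fubini_F (lam t) (fun p : r.+1.-tuple RT * t.-tuple RT =>
      F (cons_pair (thead p.1, g p.2 [tuple of behead p.1])))) //.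
    by apply: measurable_fun_fubini_tonelli_F mFg _ => p; exact: F0.
  + by move=> d; exact: integral_ge0.
  apply: eq_integral => x _; rewrite IH //.
  + apply: eq_integral => d _; apply: eq_integral => s _.
    by rewrite behead_cons_pair thead_cons_pair.
  + by apply: measurableT_comp mF _; exact: measurable_cons_pairr.
Qed.

Lemma interleave_all k t r g (P : pred RT) : @interleave k t r g ->
  forall s d, all P (g s d) = all P s && all P d.
Proof.
elim => {k t r g} [|k t r g _ IH|k t r g _ IH] s d /=.
- by rewrite [s]tuple0 [d]tuple0.
- by rewrite IH andbA [s in RHS]tuple_eta.
- by rewrite IH andbCA [d in RHS]tuple_eta.
Qed.

Lemma measurable_box n (A : 'I_n -> set RT) : (forall j, measurable (A j)) ->
  measurable [set x : n.-tuple RT | forall j, A j (tnth x j)].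
Proof.
move=> mA; have -> : [set x : n.-tuple RT | forall j, A j (tnth x j)] =
   \bigcap_(j in [set: 'I_n]) ((fun x : n.-tuple RT => tnth x j) @^-1` (A j)).
  by apply/seteqP; split => x /=; [move=> h j _; exact: h|move=> h j; exact: h].
apply: fin_bigcap_measurable => // j _.
by rewrite -[X in measurable X]setTI; apply: measurable_tnth.
Qed.

Lemma lebesgue_box n (A : 'I_n -> set RT) : (forall j, measurable (A j)) ->
  (lam n [set x : n.-tuple RT | forall j, A j (tnth x j)] = \prod_(j < n) mu (A j))%E.
Proof.
elim: n A => [|n IH] A mA.
  rewrite big_ord0 /= diracE; suff -> : ([tuple] \in [set x : 0.-tuple RT | forall j, A j (tnth x j)]) = true by [].
  by apply/mem_set => -[].
rewrite big_ord_recl -IH // /= /lebesgue_cons /pushforward.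
have -> : (@cons_pair R n) @^-1` [set x | forall j, A j (tnth x j)] =
   A ord0 `*` [set x : n.-tuple RT | forall j, A (lift ord0 j) (tnth x j)].
  apply/seteqP; split => -[x y] /=.
    move=> h; split; first exact: (h ord0).
    by move=> j; have := h (lift ord0 j); rewrite tnthS.
  move=> [h0 h1] j; case: (unliftP ord0 j) => [i ->|->] //.
  by rewrite tnthS; exact: h1.
rewrite product_measure1E //.
by apply: (measurable_box (A := fun j => A (lift ord0 j))).
Qed.

Lemma measurable_unit_cube n : measurable (unit_cube R n).
Proof.
have -> : unit_cube R n = [set x | forall j, [set` `[0, 1[%R] (tnth x j)].
  by apply/seteqP; split => x h j; have := h j; rewrite /= in_itv.
by apply: (measurable_box (A := fun=> [set` `[0, 1[%R])).
Qed.

Lemma unit_cubeE n (x : n.-tuple RT) : unit_cube R n x <-> all (fun z : R => 0 <= z < 1) x.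
Proof. by split => [h|/all_tnthP]; [apply/all_tnthP|]. Qed.

Lemma integral_unit_cube_interleave k t r g (F : k.-tuple RT -> \bar R) : @interleave k t r g ->
  measurable_fun [set: k.-tuple RT] F -> (forall x, 0 <= F x)%E ->
  (\int[lam k]_(x in unit_cube R k) F x =
   \int[lam r]_(d in unit_cube R r) \int[lam t]_(s in unit_cube R t) F (g s d))%E.
Proof.
move=> G mF F0; have mC n : measurable (unit_cube R n) := @measurable_unit_cube n.
rewrite integral_mkcond (integral_interleave G); last 2 first.
- by apply/(measurable_restrictT F (mC k)); exact: measurable_funTS.
- by move=> x; rewrite patchE; case: ifP.
rewrite [RHS]integral_mkcond; apply: eq_integral => d _.
rewrite [RHS]patchE; case: ifPn => dC.
  rewrite [RHS]integral_mkcond; apply: eq_integral => s _; rewrite !patchE.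
  suff -> : (g s d \in unit_cube R k) = (s \in unit_cube R t) by [].
  apply/idP/idP => /set_mem/unit_cubeE; rewrite ?(interleave_all _ G) => h; apply/mem_set/unit_cubeE.
    by case/andP: h.
  by rewrite (interleave_all _ G) h /=; apply/unit_cubeE/set_mem.
apply: integral0_eq => s _; rewrite patchE; case: ifPn => // /set_mem/unit_cubeE.
rewrite (interleave_all _ G) => /andP[_ h]; case/negP: dC; apply/mem_set/unit_cubeE => //.
Qed.

Lemma measurable_integral_interleave k t r g (F : k.-tuple RT -> \bar R) : @interleave k t r g ->
  measurable_fun [set: k.-tuple RT] F -> (forall x, 0 <= F x)%E ->
  measurable_fun setT (fun d : r.-tuple RT => \int[lam t]_(s in unit_cube R t) F (g s d))%E.
Proof.
move=> G mF F0; have mC : measurable (unit_cube R t) := @measurable_unit_cube t.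
pose H (p : r.-tuple RT * t.-tuple RT) : \bar R := ((fun s => F (g s p.1)) \_ (unit_cube R t)) p.2.
have -> : (fun d : r.-tuple RT => \int[lam t]_(s in unit_cube R t) F (g s d))%E =
   fubini_F (lam t) H.
  by apply/funext => d; rewrite integral_mkcond.
apply: measurable_fun_fubini_tonelli_F; last by move=> x; rewrite /H patchE; case: ifP.
have -> : H = (fun p => F (g p.2 p.1)) \_ (setT `*` unit_cube R t).
  by apply/funext => p; rewrite /H !patchE in_setX in_setT.
have mS : measurable ([set: r.-tuple RT] `*` unit_cube R t) by exact: measurableX.
apply/(measurable_restrictT _ mS).
apply: measurable_funTS; apply: measurableT_comp mF _; exact: measurable_interleave.
Qed.
End tuple_integral.

(** * Dilations of periodic functions *)

Section dilation.
Variable R : realType.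
Notation RT := (measurableTypeR R).
Notation mu := (@lebesgue_measure R).
Notation lam := (lebesgue_tuple R).
Implicit Types (n : nat) (h c : R).

Let affine h c : RT -> RT := fun x => h * x + c.

Lemma measurable_affine h c : measurable_fun setT (affine h c).
Proof. by apply: measurable_funD => //; exact: measurable_funM. Qed.

Let pushforward_affine h c : {measure set RT -> \bar R} :=
  @measure_function_pushforward__canonical__measure_function_Measure _ _ RT RT R mu
    (affine h c) (measurable_affine h c).

(** By uniqueness of Lebesgue measure it is enough to compare the two sides on the intervals []a,
    b]]. *)
Lemma lebesgue_measure_affine h c (h0 : 0 < h) (A : set RT) : measurable A ->
  (h%:E * mu (affine h c @^-1` A) = mu A)%E.
Proof.
move=> mA; apply/esym.
pose nu := mscale (NngNum (ltW h0)) (pushforward_affine h c).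
have -> : (h%:E * mu (affine h c @^-1` A))%E = nu A by [].
apply: (@lebesgue_measure_unique R nu) => // X /ocitvP[->|[[a b] /= ab ->]].
  by rewrite !measure0.
rewrite /nu /mscale /= /pushforward.
have -> : affine h c @^-1` `]a, b] = `]((a - c) / h), ((b - c) / h)]%classic.
  apply/seteqP; split => x /=; rewrite !in_itv /= /affine.
    by rewrite ltr_pdivrMr // ler_pdivlMr // ltrBlDr lerBrDr mulrC.
  by rewrite ltr_pdivrMr // ler_pdivlMr // ltrBlDr lerBrDr mulrC.
rewrite !lebesgue_measure_itv /= !lte_fin ab ltr_pM2r ?invr_gt0 // ltrD2r ab.
by rewrite -!EFinD -EFinM; congr EFin; field; rewrite gt_eqF.
Qed.

Lemma integral_affine h c (f : RT -> \bar R) (D : set RT) : 0 < h -> measurable D ->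
  measurable_fun [set: RT] f -> (forall x, 0 <= f x)%E ->
  (h%:E * \int[mu]_(x in affine h c @^-1` D) f (affine h c x) = \int[mu]_(x in D) f x)%E.
Proof.
move=> h0 mD mf f0.
have := @ge0_integral_pushforward _ _ _ _ R _ (@measurable_affine h c)
   mu D f mD (measurable_funTS mf) (fun y _ => f0 y).
move=> <-; rewrite -(@ge0_integral_mscale _ _ R (pushforward_affine h c) _ mD (NngNum (ltW h0))) //; last exact: measurable_funTS.
apply: eq_measure_integral => A mA _.
exact: lebesgue_measure_affine.
Qed.

Definition periodic1 (f : R -> \bar R) := forall x, f (x + 1) = f x.

Lemma periodic1_nat f n x : periodic1 f -> f (x + n%:R) = f x.
Proof. by move=> fP; elim: n => [|n IH]; rewrite ?addr0 // -natr1 addrA fP. Qed.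

(** The unit interval is cut at the multiples of [1 / h]. On each piece the substitution [h x - j]
    and periodicity give [1 / h] of the full integral. *)
Lemma integral01_dilation (f : RT -> \bar R) (h : nat) : (0 < h)%N -> periodic1 f ->
  measurable_fun [set: RT] f -> (forall x, 0 <= f x)%E ->
  (\int[mu]_(x in `[0%R, 1%R[) f (h%:R * x)%R = \int[mu]_(x in `[0%R, 1%R[) f x)%E.
Proof.
move=> h0 fP mf f0; have hR : 0 < h%:R :> R by rewrite ltr0n.
have mfh : measurable_fun [set: RT] (fun x : RT => f (h%:R * x)%R).
  by apply: measurableT_comp mf _; exact: measurable_funM.
have piece (j : nat) : (\int[mu]_(x in `[(j%:R / h%:R)%R, (j.+1%:R / h%:R)%R[) f (h%:R * x)%R =
    (h%:R^-1)%:E * \int[mu]_(x in `[0%R, 1%R[) f x)%E.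
  rewrite -(@integral_affine h%:R (- j%:R) f `[0%R, 1%R[) // muleA -EFinM mulVf ?gt_eqF // mul1e.
  have -> : affine h%:R (- j%:R) @^-1` `[0, 1[ = `[(j%:R / h%:R), (j.+1%:R / h%:R)[%classic.
    have E (x : R) : (0 <= h%:R * x - j%:R < 1) = (j%:R / h%:R <= x < j.+1%:R / h%:R).
      by rewrite ler_pdivrMr // ltr_pdivlMr // [x * _]mulrC subr_ge0 ltrBlDr [1 + _]addrC natr1.
    by apply/seteqP; split => x /=; rewrite !in_itv /= /affine E.
  apply: eq_integral => x _; rewrite /affine.
  by rewrite -[in LHS](subrK j%:R (h%:R * x)) periodic1_nat.
have sum (n : nat) : (\int[mu]_(x in `[0%R, (n%:R / h%:R)%R[) f (h%:R * x)%R =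
    (n%:R / h%:R)%:E * \int[mu]_(x in `[0%R, 1%R[) f x)%E.
  elim: n => [|n IH]; first by rewrite !mul0r set_itv_ge ?bnd_simp ?ltxx // integral_set0 mul0e.
  have -> : `[0%R, (n.+1%:R / h%:R)%R[%classic = 
     `[0%R, (n%:R / h%:R)%R[%classic `|` `[(n%:R / h%:R)%R, (n.+1%:R / h%:R)%R[%classic :> set R.
    rewrite -itv_bndbnd_setU // bnd_simp ?divr_ge0 //.
    by rewrite ler_pM2r ?invr_gt0 // ler_nat.
  rewrite ge0_integral_setU //; last 2 first.
  - exact: measurable_funTS.
  - apply/disj_setPS => x [] /=; rewrite !in_itv /= => /andP[_ h1] /andP[h2 _].
    by have := lt_le_trans h1 h2; rewrite ltxx.
  rewrite IH piece -ge0_muleDl ?lee_fin ?divr_ge0 ?invr_ge0 //.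
  by rewrite -EFinD -natr1 mulrDl mul1r.
by have := sum h; rewrite divff ?gt_eqF // mul1e.
Qed.

Lemma integral_unit_cube_cons n (F : n.+1.-tuple RT -> \bar R) :
  measurable_fun [set: n.+1.-tuple RT] F -> (forall x, 0 <= F x)%E ->
  (\int[lam n.+1]_(x in unit_cube R n.+1) F x =
   \int[mu]_(x in `[0%R, 1%R[) \int[lam n]_(y in unit_cube R n) F (cons_pair (x, y)))%E.
Proof.
move=> mF F0; have mC m : measurable (unit_cube R m) := @measurable_unit_cube R m.
rewrite integral_mkcond integral_cons; last 2 first.
- by apply/(measurable_restrictT F (mC _)); exact: measurable_funTS.
- by move=> x; rewrite patchE; case: ifP.
rewrite [RHS]integral_mkcond; apply: eq_integral => x _.
have E (y : n.-tuple RT) : (cons_pair (x, y) \in unit_cube R n.+1) = (x \in `[0, 1[%classic) && (y \in unit_cube R n).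
  apply/idP/andP => [/set_mem/unit_cubeE /= /andP[h1 h2]|[/set_mem h1 /set_mem/unit_cubeE h2]].
    by split; apply/mem_set; [rewrite /= in_itv|exact/unit_cubeE].
  by apply/mem_set/unit_cubeE => /=; rewrite h2 andbT; move: h1; rewrite /= in_itv.
rewrite [RHS]patchE; case: ifPn => xI.
  rewrite [RHS]integral_mkcond; apply: eq_integral => y _; rewrite !patchE E xI //.
by apply: integral0_eq => y _; rewrite patchE E (negbTE xI).
Qed.

Definition dilate n (h : R) (x : n.-tuple RT) : n.-tuple RT := [tuple of map (fun z : R => h * z) x].

(** Translations by natural numbers suffice: a dilated point is always a point of the unit interval
    moved up by some [j]. *)
Definition periodic n (F : n.-tuple RT -> \bar R) :=
  forall x y : n.-tuple RT, (forall j, exists m : nat, tnth y j = (tnth x j : R) + m%:R) -> F y = F x.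

Lemma measurable_dilate n (h : R) : measurable_fun setT (@dilate n h).
Proof.
apply/measurable_fun_tnthP => j.
have -> : (@tnth n RT)^~ j \o dilate h = (fun z : RT => h * z : RT) \o (fun x : n.-tuple RT => tnth x j).
  by apply/funext => x /=; rewrite tnth_map.
by apply: measurableT_comp; [exact: measurable_funM|exact: measurable_tnth].
Qed.

(** Induction on the dimension: the inner coordinates are handled with the first one frozen at
    [h x], and the one-dimensional case is then applied to the resulting function [G] of the first
    coordinate. *)
Lemma integral_unit_cube_dilation n (h : nat) (F : n.-tuple RT -> \bar R) : (0 < h)%N ->
  periodic F -> measurable_fun [set: n.-tuple RT] F -> (forall x, 0 <= F x)%E ->
  (\int[lam n]_(x in unit_cube R n) F (dilate h%:R x) = \int[lam n]_(x in unit_cube R n) F x)%E.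
Proof.
move=> h0; elim: n F => [|n IH] F FP mF F0.
  by apply: eq_integral => x _; congr F; apply: val_inj; rewrite [x]tuple0.
have mC m : measurable (unit_cube R m) := @measurable_unit_cube R m.
have mFd : measurable_fun [set: n.+1.-tuple RT] (fun x => F (dilate h%:R x)).
  by apply: measurableT_comp mF _; exact: measurable_dilate.
rewrite integral_unit_cube_cons // [RHS]integral_unit_cube_cons //.
pose G (x : RT) : \bar R := (\int[lam n]_(y in unit_cube R n) F (cons_pair (x, y)))%E.
have mFc x : measurable_fun [set: n.-tuple RT] (fun y => F (cons_pair (x, y))).
  by apply: measurableT_comp mF _; exact: measurable_cons_pairr.
have GP : periodic1 G.
  move=> x; apply: eq_integral => y _; apply: FP => j.
  case: (unliftP ord0 j) => [i ->|->]; last by exists 1%N.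
  by exists 0%N; rewrite !tnthS addr0.
have mG : measurable_fun [set: RT] G.
  pose H (p : RT * n.-tuple RT) : \bar R := ((fun y => F (cons_pair (p.1, y))) \_ (unit_cube R n)) p.2.
  have -> : G = fubini_F (lam n) H by apply/funext => d; rewrite /G integral_mkcond.
  apply: measurable_fun_fubini_tonelli_F; last by move=> x; rewrite /H patchE; case: ifP.
  have -> : H = (fun p => F (cons_pair p)) \_ ([set: RT] `*` unit_cube R n).
    by apply/funext => -[x y]; rewrite /H !patchE in_setX in_setT.
  have mS : measurable ([set: RT] `*` unit_cube R n) by exact: measurableX.
  apply/(measurable_restrictT _ mS).
  by apply: measurable_funTS; apply: measurableT_comp mF _; exact: measurable_cons_pair.
rewrite -(integral01_dilation h0 GP mG) //; last by move=> x; exact: integral_ge0.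
apply: eq_integral => x _; rewrite /G -(IH (fun y => F (cons_pair (h%:R * x, y)))) //.
- apply: eq_integral => y _; congr F; exact: val_inj.
- move=> y y' yy'; apply: FP => j; case: (unliftP ord0 j) => [i ->|->]; last by exists 0%N; rewrite addr0.
  by rewrite !tnthS.
Qed.
End dilation.

(** * Moments of Weyl sums *)

Section assembly.
Variable R : realType.
Notation RT := (measurableTypeR R).
Notation mu := (@lebesgue_measure R).
Notation lam := (lebesgue_tuple R).

Let asm a n (i : seq nat) (s d : seq R) : seq R :=
  [seq if j \in i then nth 0 s (index j i)
       else nth 0 d (index j [seq j' <- iota a n | j' \notin i]) | j <- iota a n].

(** The starting index [a] is left general for the induction. Since [i] is increasing with entries
    at least [a], the index [a] can only be its head; it then goes to the left tuple, and otherwise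
    to the right one. *)
Let interleave_asm n a t r (i : seq nat) : size i = t -> (t + r = n)%N ->
  sorted ltn i -> all (fun j => a <= j < a + n)%N i ->
  exists2 g : t.-tuple RT -> r.-tuple RT -> n.-tuple RT, interleave g &
    forall s d, val (g s d) = asm a n i s d.
Proof.
elim: n a t r i => [|n IH] a t r i st trn si ri.
  have -> : i = [::] by case: i st si ri => //= j i _ _ /andP[]; rewrite addn0; lia.
  have [t0 r0] : t = 0%N /\ r = 0%N by lia.
  by rewrite t0 r0; refine (ex_intro2 _ _ _ (@interleave_nil R) _).
have ui : uniq i by apply: (sorted_uniq ltn_trans ltnn).
have neq j : j \in iota a.+1 n -> (j == a) = false by rewrite mem_iota; lia.
case: i st si ri ui => [|b i] st si ri ui.
  have rE : r = r.-1.+1 by move: st => /=; lia.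
  have e : (t + r.-1)%N = n by lia.
  have [g Gg gE] := IH a.+1 t r.-1 [::] st e isT isT.
  rewrite rE; exists (fun s d => cons_pair (thead d, g s [tuple of behead d])); first exact: interleave_right.
  move=> s d; rewrite /= /asm /= eqxx; congr (_ :: _); first by rewrite [d in RHS]tuple_eta.
  rewrite gE /asm; apply/eq_in_map => j /neq ja /=.
  by rewrite (eq_sym a) ja [d in RHS]tuple_eta.
have [ba|ba] := eqVneq b a.
  subst b; have tE : t = t.-1.+1 by move: st => /=; lia.
  have si' : sorted ltn i := path_sorted si.
  have ri' : all (fun j => (a.+1 <= j < a.+1 + n)%N) i.
    apply/allP => j ji; move/allP: ri => /(_ j); rewrite inE ji orbT => /(_ isT).
    have : (a < j)%N by apply: (allP (order_path_min ltn_trans si)).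
    by lia.
  have st' : size i = t.-1 by move: st => /=; lia.
  have e : (t.-1 + r)%N = n by lia.
  have [g Gg gE] := IH a.+1 t.-1 r i st' e si' ri'.
  rewrite tE; exists (fun s d => cons_pair (thead s, g [tuple of behead s] d)); first exact: interleave_left.
  move=> s d; rewrite /= /asm /= inE eqxx /=; congr (_ :: _); first by rewrite [s in RHS]tuple_eta.
  rewrite gE /asm; apply/eq_in_map => j jn; have ja := neq _ jn.
  rewrite inE ja (eq_sym a) ja /= [s in RHS]tuple_eta /=.
  suff -> : [seq j' <- iota a.+1 n | j' \notin a :: i] = [seq j' <- iota a.+1 n | j' \notin i] by [].
  by apply/eq_in_filter => j' /neq j'a; rewrite inE j'a.
have ri' : all (fun j => (a.+1 <= j < a.+1 + n)%N) (b :: i).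
  apply/allP => j ji; move/allP: (ri) => /(_ j ji).
  have b1 : (a < b)%N by move: ri => /= /andP[]; lia.
  move: ji; rewrite inE => /predU1P[->|ji]; first by lia.
  have : (b < j)%N by apply: (allP (order_path_min ltn_trans si)).
  by lia.
have ai : a \notin b :: i by apply/negP => /(allP ri'); lia.
have sn : (size (b :: i) <= n)%N.
  rewrite -(size_iota a.+1 n); apply: uniq_leq_size => // j /(allP ri').
  by rewrite mem_iota.
have rE : r = r.-1.+1 by lia.
clear sn ri ui; move: (b :: i) st si ri' ai => B st si ri' ai.
have e : (t + r.-1)%N = n by lia.
have [g Gg gE] := IH a.+1 t r.-1 B st e si ri'.
rewrite rE; exists (fun s d => cons_pair (thead d, g s [tuple of behead d])); first exact: interleave_right.
move=> s d; rewrite /= gE /asm /= ai (negbTE ai) /= eqxx.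
congr (_ :: _); first by rewrite [d in RHS]tuple_eta.
apply/eq_in_map => j /neq ja; case: ifP => // _.
by rewrite (eq_sym a) ja [d in RHS]tuple_eta.
Qed.

Lemma interleave_assemble k t (i : t.-tuple nat) : (t <= k)%N -> sorted ltn i ->
  all (fun j => (1 <= j <= k)%N) i ->
  @interleave R k t (k - t) (assemble k i).
Proof.
move=> tk si ri; have e : (t + (k - t))%N = k by lia.
have ri' : all (fun j => (1 <= j < 1 + k)%N) i by apply: sub_all ri => j; lia.
have [g Gg gE] := @interleave_asm k 1 t (k - t) i (size_tuple i) e si ri'.
suff -> : assemble k i = g :> (t.-tuple R -> (k - t).-tuple R -> k.-tuple R) by [].
apply/funext => s; apply/funext => d; apply: val_inj; rewrite gE /asm /=.
set C := [seq j' <- iota 1 k | _].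
have -> : iota 1 k = [seq (val j).+1 | j <- enum 'I_k].
  by rewrite (map_comp S (fun j : 'I_k => val j)) val_enum_ord (iotaDl 1 0 k : iota 1 k = _).
by rewrite -map_comp.
Qed.

(** A change of at most [eta / (k M ^ j)] in the coefficient of degree [j] changes its term by at
    most [eta / k] for [m <= M], and there are [k] degrees. *)
Lemma phase_assemble_dist k t (i : t.-tuple nat) (s s' : t.-tuple R) (d : (k - t).-tuple R)
    (eta : R) (M m : nat) :
  (0 < k)%N -> 0 <= eta -> (1 <= m <= M)%N ->
  (forall l : 'I_t, `|tnth s' l - tnth s l| <= eta / (k%:R * M%:R ^+ tnth i l)) ->
  `|phase (assemble k i s' d) m - phase (assemble k i s d) m| <= eta.
Proof.
move=> k0 eta0 /andP[m0 mM] close; rewrite /phase -sumrB.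
have kR : 0 < k%:R :> R by rewrite ltr0n.
have mR : 0 < m%:R :> R by rewrite ltr0n.
have MR : 0 < M%:R :> R by rewrite ltr0n (leq_trans m0).
have -> : eta = \sum_(j < k) (eta / k%:R).
  by rewrite sumr_const card_ord -[RHS]mulr_natr divfK // gt_eqF.
apply: le_trans (ler_norm_sum _ _ _) _; apply: ler_sum => j _.
rewrite -mulrBl normrM !tnth_mktuple.
case: ifPn => ji; last by rewrite subrr normr0 mul0r divr_ge0 // ltW.
have ls : (index j.+1 i < t)%N by rewrite -[X in (_ < X)%N](size_tuple i) index_mem.
have := close (Ordinal ls); rewrite !(tnth_nth 0) /= nth_index // => c.
apply: le_trans (ler_wpM2r (normr_ge0 _) c) _.
rewrite ger0_norm ?exprn_ge0 ?(ltW mR) // invfM (mulrA eta) -(mulrA (eta / _)).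
rewrite ler_piMr ?divr_ge0 ?(ltW kR) //.
by rewrite mulrC ler_pdivrMr ?exprn_gt0 // mul1r ler_pXn2r ?nnegrE ?(ltW mR) ?(ltW MR) // ler_nat.
Qed.

(** A substitute for Jensen's inequality, from the pointwise bound [y <= l + l ^ (1 - q) y ^ q]. The
    factor 2 in the hypothesis pays for the summand [l]. *)
Lemma weighted_power_mean n (c y : 'I_n -> R) (l q : R) : 0 < l -> 1 <= q ->
  (forall h, 0 <= c h) -> (forall h, 0 <= y h) ->
  2 * l * \sum_h c h <= \sum_h c h * y h ->
  l `^ q * \sum_h c h <= \sum_h c h * y h `^ q.
Proof.
move=> l0 q1 c0 y0 H.
have step h : y h <= l + l `^ (1 - q) * y h `^ q.
  have [yl|yl] := leP (y h) l; first by rewrite ler_wpDr // mulr_ge0 // powR_ge0.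
  apply: (ler_wpDl (ltW l0)).
  have yh0 : 0 < y h by exact: lt_trans yl.
  have {1}-> : y h = y h `^ (1 - q) * y h `^ q.
    by rewrite -powRD ?subrK ?powRr1 // (gt_eqF yh0) implybT.
  rewrite ler_wpM2r ?powR_ge0 // -(opprB q 1) !powRN lef_pV2 ?posrE ?powR_gt0 //.
  by apply: ge0_ler_powR; rewrite ?nnegrE ?subr_ge0 // ltW.
have : \sum_h c h * y h <= l * \sum_h c h + l `^ (1 - q) * \sum_h c h * y h `^ q.
  rewrite !mulr_sumr -big_split /=; apply: ler_sum => h _.
  apply: le_trans (ler_wpM2l (c0 h) (step h)) _.
  by rewrite mulrDr mulrC [c h * (_ * _)]mulrCA.
move=> /(le_trans H) {}H.
have {}H : l * \sum_h c h <= l `^ (1 - q) * \sum_h c h * y h `^ q by lra.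
have lq : l `^ (q - 1) * l = l `^ q.
  by rewrite -[X in _ * X](powRr1 (ltW l0)) -powRD ?subrK // (gt_eqF l0) implybT.
have lq1 : l `^ (q - 1) * l `^ (1 - q) = 1.
  by rewrite -powRD ?(gt_eqF l0) ?implybT // addrA subrK subrr powRr0.
by have := ler_wpM2l (powR_ge0 l (q - 1)) H; rewrite !mulrA lq lq1 mul1r.
Qed.
End assembly.

(** * Measurability, periodicity and size of the moments *)

Section moments.
Variable R : realType.
Notation RT := (measurableTypeR R).
Notation lam := (lebesgue_tuple R).
Implicit Types (M h : nat) (u : R).

Lemma normc_powR (a b u : R) : Normc.normc (a +i* b)%C `^ (2 * u) = (a ^+ 2 + b ^+ 2) `^ u.
Proof.
have ab : 0 <= a ^+ 2 + b ^+ 2 by rewrite addr_ge0 // sqr_ge0.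
by rewrite /= -powR12_sqrt // -powRrM mulrA mulVf ?mul1r.
Qed.

Definition moment_fun k u M (alpha : k.-tuple R) : R :=
  Normc.normc (\sum_(1 <= m < M.+1) e2pi (phase alpha m)) `^ (2 * u).

Lemma moment_fun_ge0 k u M (alpha : k.-tuple R) : 0 <= moment_fun u M alpha.
Proof. exact: powR_ge0. Qed.

Lemma measurable_phase k m : measurable_fun setT (fun alpha : k.-tuple RT => phase alpha m : R).
Proof. by apply: measurable_sum => j; apply: measurable_funM => //; exact: measurable_tnth. Qed.

Lemma measurable_moment_fun k u M :
  measurable_fun setT (fun alpha : k.-tuple RT => (moment_fun u M alpha)%:E).
Proof.
apply/measurable_EFinP.
rewrite [X in measurable_fun _ X](_ : _ = (fun z : R => z `^ u) \o
   (fun alpha : k.-tuple RT => (\sum_(1 <= m < M.+1) cos (2 * pi * phase alpha m)) ^+ 2 +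
             (\sum_(1 <= m < M.+1) sin (2 * pi * phase alpha m)) ^+ 2)); last first.
  by apply/funext => alpha /=; rewrite /moment_fun sum_e2pi normc_powR.
have m2 m : measurable_fun setT (fun alpha : k.-tuple RT => 2 * pi * (phase alpha m : R)).
  by apply: measurable_funM => //; exact: measurable_phase.
apply: measurableT_comp; first exact: measurable_powR.
apply: measurable_funD; apply: measurable_funX; apply: measurable_sum => m.
  by apply: measurableT_comp (m2 m); apply: continuous_measurable_fun; exact: continuous_cos.
by apply: measurableT_comp (m2 m); apply: continuous_measurable_fun; exact: continuous_sin.
Qed.

Lemma phase_dilate k h (alpha : k.-tuple R) m :
  phase (dilate h%:R alpha) m = h%:R * phase alpha m.
Proof.
by rewrite /phase mulr_sumr; apply: eq_bigr => j _; rewrite tnth_map mulrA.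
Qed.

Lemma moment_fun_periodic k u M : periodic (fun alpha : k.-tuple RT => (moment_fun u M alpha)%:E).
Proof.
move=> x y xy; congr EFin; rewrite /moment_fun !sum_e2pi.
have E m : exists p : nat, phase y m = phase x m + p%:R :> R.
  rewrite /phase; elim/big_rec2: _ => [|j a b _ [p ->]]; first by exists 0%N; rewrite addr0.
  have [q ->] := xy j; exists (q * m ^ j.+1 + p)%N.
  by rewrite natrD natrM natrX; ring.
have -> : \sum_(1 <= m < M.+1) cos (2 * pi * phase y m) = \sum_(1 <= m < M.+1) cos (2 * pi * phase x m).
  by apply: eq_bigr => m _; have [p ->] := E m; rewrite cos_2pi_nat.
have -> // : \sum_(1 <= m < M.+1) sin (2 * pi * phase y m) = \sum_(1 <= m < M.+1) sin (2 * pi * phase x m).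
by apply: eq_bigr => m _; have [p ->] := E m; rewrite sin_2pi_nat.
Qed.

(** The mean value conjecture enters at the exponent [s = u], where [u <= k (k + 1) / 2] makes
    [X ^ u] the larger of its two terms. The bound is uniform in the dilation [h] by periodicity. *)
Lemma MC_moment k u (hu : 1 <= u <= k%:R * (k%:R + 1) / 2) (hMC : MC k u) (delta : R) :
  0 < delta -> exists2 C : R, 0 <= C & forall M h, (0 < M)%N -> (0 < h)%N ->
  (\int[lam k]_(alpha in unit_cube R k) (moment_fun u M (dilate h%:R alpha))%:E
     <= (C * M%:R `^ (u + delta))%:E)%E.
Proof.
move=> d0; have [|C HC] := hMC u _ delta d0; first by have /andP[-> _] := hu; rewrite lexx.
(* [MC] does not fix the sign of its constant, hence the absolute value; the 2 accounts for the two
   powers of [X]. *)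
exists (2 * `|C|); first by rewrite mulr_ge0.
move=> M h M0 h0.
have MR : 1 <= M%:R :> R by rewrite ler1n.
have MRp : 0 < M%:R :> R by rewrite ltr0n.
rewrite (@integral_unit_cube_dilation R k h (fun alpha => (moment_fun u M alpha)%:E)) //; last 3 first.
- exact: moment_fun_periodic.
- exact: measurable_moment_fun.
- by move=> x; rewrite lee_fin moment_fun_ge0.
have := HC M%:R MR; rewrite /weyl_sum natrK => /le_trans; apply.
rewrite lee_fin.
have E : M%:R `^ (u + delta) = M%:R `^ delta * M%:R `^ u :> R.
  by rewrite addrC powRD // (gt_eqF MRp) implybT.
have le2 : M%:R `^ (2 * u - k%:R * (k%:R + 1) / 2) <= M%:R `^ u :> R.
  by rewrite ler_powR //; lra.
have p0 := powR_ge0 (M%:R : R) delta.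
apply: le_trans (_ : `|C| * (M%:R `^ delta * (2 * M%:R `^ u)) <= _); last by rewrite E; lra.
rewrite -(mulrA C); apply: le_trans (ler_wpM2r _ (ler_norm C)) _.
  by rewrite mulr_ge0 // addr_ge0 // powR_ge0.
by do 2 (rewrite ler_wpM2l //); lra.
Qed.
End moments.

(** * Exceptional sets *)

Section exceptional_set.
Variable R : realType.
Notation RT := (measurableTypeR R).
Notation mu := (@lebesgue_measure R).
Notation lam := (lebesgue_tuple R).
Implicit Types (k t n M : nat) (u a b T J : R).

Definition harmonic_sum n : R := \sum_(h < n) h.+1%:R^-1.

Lemma harmonic_sum_gt0 n : (0 < n)%N -> 0 < harmonic_sum n.
Proof.
case: n => // n _; rewrite /harmonic_sum big_ord_recl ltr_pwDl // ?invr_gt0 ?ltr0n //.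
by apply: sumr_ge0 => h _; rewrite invr_ge0.
Qed.

Definition harmonic_moment k u n M (alpha : k.-tuple R) : R :=
  \sum_(h < n) h.+1%:R^-1 * moment_fun u M (dilate h.+1%:R alpha).

Lemma harmonic_moment_ge0 k u n M (alpha : k.-tuple R) : 0 <= harmonic_moment u n M alpha.
Proof. by apply: sumr_ge0 => h _; rewrite mulr_ge0 ?invr_ge0 ?moment_fun_ge0. Qed.

Lemma measurable_moment_fun_dilate k u M (h : R) :
  measurable_fun setT (fun alpha : k.-tuple RT => (moment_fun u M (dilate h alpha))%:E).
Proof.
exact: (measurableT_comp (@measurable_moment_fun R k u M) (@measurable_dilate R k h)).
Qed.

Lemma harmonic_momentE k u n M (alpha : k.-tuple R) : (harmonic_moment u n M alpha)%:E =
  (\sum_(h < n) (h.+1%:R^-1)%:E * (moment_fun u M (dilate h.+1%:R alpha))%:E)%E.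
Proof. by rewrite -sumEFin; apply: eq_bigr => h _; rewrite EFinM. Qed.

Lemma measurable_harmonic_moment k u n M :
  measurable_fun setT (fun alpha : k.-tuple RT => (harmonic_moment u n M alpha)%:E).
Proof.
apply: (eq_measurable_fun _ (fun alpha _ => esym (harmonic_momentE u n M alpha))).
apply: emeasurable_sum => h; apply: emeasurable_funM => //.
exact: measurable_moment_fun_dilate.
Qed.

Lemma integral_harmonic_moment_le k u n M J :
  (forall h, (0 < h)%N -> (\int[lam k]_(alpha in unit_cube R k)
     (moment_fun u M (dilate h%:R alpha))%:E <= J%:E)%E) ->
  (\int[lam k]_(alpha in unit_cube R k) (harmonic_moment u n M alpha)%:E
     <= (harmonic_sum n * J)%:E)%E.
Proof.
move=> HJ; have mC : measurable (unit_cube R k) := @measurable_unit_cube R k.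
under eq_integral do rewrite harmonic_momentE.
rewrite ge0_integral_sum //; last 2 first.
- move=> h; apply: measurable_funTS; apply: emeasurable_funM => //.
  exact: measurable_moment_fun_dilate.
- by move=> h x _; rewrite mule_ge0 // lee_fin ?invr_ge0 ?moment_fun_ge0.
rewrite /harmonic_sum mulr_suml -sumEFin; apply: lee_sum => h _.
rewrite ge0_integralZl_EFin //; last 2 first.
- by move=> x _; rewrite lee_fin moment_fun_ge0.
- by apply: measurable_funTS; exact: measurable_moment_fun_dilate.
by rewrite EFinM lee_wpmul2l ?lee_fin ?invr_ge0 // HJ.
Qed.

(** Both parameters [w] and [eta] of [Zcount_discrepancy] are [T / (16 M)]. The choice of [n] gives
    [n w ^ 3 = T ^ 3 >= 1], so the third error term is at most [w] and all of them together at most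
    [4 M w = T / 4]. A discrepancy above [T] thus leaves at least [T / 4] for the exponential
    sums. *)
Lemma harmonic_moment_lower k (alpha alpha' : k.-tuple R) u M a b T n :
  n = ((16 * M) ^ 3)%N -> 1 <= u -> 1 <= T -> T <= M%:R ->
  0 <= a -> a < b -> b <= 1 ->
  (forall m, (1 <= m <= M)%N ->
     `|phase alpha' m - phase alpha m| <= T / (16 * M%:R)) ->
  T < `|(Zcount a b alpha M%:R)%:R - (b - a) * M%:R| ->
  (T / (8 * harmonic_sum n)) `^ (2 * u) * harmonic_sum n <= harmonic_moment u n M alpha'.
Proof.
move=> nE u1 T1 TM a0 ab b1 close big.
have T0 : 0 < T by lra.
have MR : 0 < M%:R :> R by lra.
have M0 : (0 < M)%N by rewrite -(ltr0n R).
have n0 : (0 < n)%N by rewrite nE expn_gt0 muln_gt0 M0.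
set w := T / (16 * M%:R) in close.
have w0 : 0 < w by rewrite divr_gt0 ?mulr_gt0.
have Mw : M%:R * w = T / 16 by rewrite /w; field; rewrite gt_eqF.
have w1 : w <= 1 / 8 by rewrite /w ler_pdivrMr ?mulr_gt0 //; lra.
have nw : n%:R * w ^+ 3 = T ^+ 3.
  by rewrite nE natrX natrM /w; field; rewrite gt_eqF.
clearbody w.
have tauw : (n%:R * w ^+ 2)^-1 <= w.
  rewrite -[leLHS]div1r ler_pdivrMr ?mulr_gt0 ?exprn_gt0 ?ltr0n //.
  rewrite [leRHS](_ : _ = T ^+ 3); first by rewrite exprn_ege1.
  by rewrite -nw; ring.
have w01 : 0 < w <= 1 / 8 by rewrite w0.
have H := Zcount_discrepancy n0 w01 (ltW w0) a0 ab b1 close.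
have Phi : T / 4 <= harmonic_exp_sum n M (phase alpha').
  have : M%:R * (w + 2 * w + (n%:R * w ^+ 2)^-1) <= M%:R * (4 * w).
    by rewrite ler_pM2l //; lra.
  by move: (lt_le_trans big H) Mw; lra.
have L0 := harmonic_sum_gt0 n0.
have hm : harmonic_moment u n M alpha' = \sum_(h < n) h.+1%:R^-1 *
   Normc.normc (\sum_(1 <= m < M.+1) e2pi (h.+1%:R * phase alpha' m)) `^ (2 * u).
  apply: eq_bigr => h _; rewrite /moment_fun.
  by under eq_bigr do rewrite phase_dilate.
rewrite hm; apply: weighted_power_mean; rewrite -?/(harmonic_sum n).
- by rewrite divr_gt0 ?mulr_gt0.
- by lra.
- by move=> h; rewrite invr_ge0.
- by move=> h; exact: normc_ge0.
(* With [l = T / (8 * harmonic_sum n)] the hypothesis of the power mean bound asks for exactly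
   [T / 4]. *)
apply: le_trans Phi; rewrite -/(harmonic_sum n) le_eqVlt; apply/orP; left; apply/eqP.
by field; rewrite gt_eqF.
Qed.

(** The bad [d] need not form a measurable set. They are covered by a superlevel set of [g], the
    moment integrated over the coordinates [s], whose measure is bounded by Markov's inequality. *)
Lemma exceptional_set_cover k t (i : t.-tuple nat) u M T J n :
  (0 < k)%N -> (t <= k)%N -> sorted ltn i -> all (fun j => (1 <= j <= k)%N) i ->
  n = ((16 * M) ^ 3)%N -> 1 <= u -> 1 <= T -> T <= M%:R ->
  (forall h, (0 < h)%N -> (\int[lam k]_(alpha in unit_cube R k)
     (moment_fun u M (dilate h%:R alpha))%:E <= J%:E)%E) ->
  exists A : set ((k - t).-tuple RT), [/\ measurable A,
    (lam (k - t) A <= (J / ((T / (16 * M%:R) / k%:R) ^+ t / M%:R ^+ (\sum_(j <- i) j)%N *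
        (T / (8 * harmonic_sum n)) `^ (2 * u)))%:E)%E &
    forall d s a b, unit_cube R (k - t) d -> unit_cube R t s -> 0 <= a -> a < b -> b <= 1 ->
      T < `|(Zcount a b (assemble k i s d) M%:R)%:R - (b - a) * M%:R| -> A d].
Proof.
move=> k0 tk si ri nE u1 T1 TM HJ.
have G := interleave_assemble R tk si ri.
have T0 : 0 < T by lra.
have MR : 0 < M%:R :> R by lra.
have M0 : (0 < M)%N by rewrite -(ltr0n R).
have n0 : (0 < n)%N by rewrite nE expn_gt0 muln_gt0 M0.
have kR : 0 < k%:R :> R by rewrite ltr0n.
have L0 := harmonic_sum_gt0 n0.
set eta := T / (16 * M%:R).
have eta0 : 0 < eta by rewrite divr_gt0 ?mulr_gt0.
have eta1 : eta <= 1 / 16 by rewrite /eta ler_pdivrMr ?mulr_gt0 //; lra.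
set v := (eta / k%:R) ^+ t / M%:R ^+ _; set l := T / _.
have l0 : 0 < l by rewrite divr_gt0 ?mulr_gt0.
have v0 : 0 < v by rewrite divr_gt0 // exprn_gt0 // divr_gt0.
pose F (alpha : k.-tuple RT) := (harmonic_moment u n M alpha)%:E.
have mF : measurable_fun [set: k.-tuple RT] F by exact: measurable_harmonic_moment.
have F0 alpha : (0 <= F alpha)%E by rewrite lee_fin harmonic_moment_ge0.
pose g (d : (k - t).-tuple RT) : \bar R := (\int[lam t]_(s in unit_cube R t) F (assemble k i s d))%E.
have mg : measurable_fun setT g by exact: (measurable_integral_interleave G mF F0).
have g0 d : (0 <= g d)%E by exact: integral_ge0.
(* The level is the volume [v] of a box around a bad point times the lower bound for the moment on
   that box. *)
pose c := v * (l `^ (2 * u) * harmonic_sum n).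
have lu0 : 0 < l `^ (2 * u) by exact: powR_gt0.
have c0 : 0 < c by exact: mulr_gt0 v0 (mulr_gt0 lu0 L0).
have mC m : measurable (unit_cube R m) := @measurable_unit_cube R m.
exists (unit_cube R (k - t) `&` [set d | c%:E <= `|g d|]%E); split.
- rewrite -[X in _ `&` X]setTI setIA setIT.
  have mag : measurable_fun (unit_cube R (k - t)) (fun d => `|g d|%E).
    by apply: measurableT_comp => //; exact: measurable_funTS.
  exact: (emeasurable_fun_c_infty (mC _) mag).
- have := @le_integral_abse _ _ R (lam (k - t)) _ (mC _) g c (measurable_funTS mg) c0.
  under eq_integral do rewrite gee0_abs //.
  rewrite -(integral_unit_cube_interleave G mF F0) => /le_trans/(_ (integral_harmonic_moment_le n HJ)).
  set A := lam (k - t) _ => HA.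
  rewrite -(@lee_pmul2l _ c%:E) ?fin_numE // ?lte_fin // (le_trans HA) // -EFinM lee_fin.
  (* The factor [harmonic_sum n] of the integral cancels against that of [c]. *)
  rewrite le_eqVlt; apply/orP; left; apply/eqP; rewrite /c; field.
  by rewrite (gt_eqF v0) (gt_eqF lu0).
move=> d s a b dC sC a0 ab b1 big; split => //=; rewrite gee0_abs //.
have mFd : measurable_fun [set: t.-tuple RT] (fun s => F (assemble k i s d)).
  apply: measurableT_comp mF _.
  apply: (measurableT_comp (measurable_interleave G) (g := fun s => (d, s))).
  by apply: measurable_fun_pair => //; exact: measurable_cst.
have mCt := mC t.
pose dl (j : 'I_t) : R := eta / (k%:R * M%:R ^+ tnth i j).
have dl0 j : 0 < dl j by rewrite divr_gt0 // mulr_gt0 // exprn_gt0.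
have dl1 j : dl j <= 1 / 2.
  have : 1 <= k%:R * M%:R ^+ tnth i j :> R.
    by rewrite -natrX -natrM ler1n muln_gt0 k0 expn_gt0 M0.
  by move=> h; rewrite ler_pdivrMr ?mulr_gt0 ?exprn_gt0 //; lra.
(* The side extends from [s] towards the farther end of the unit interval; as its length is at most
   [1 / 2], the box stays inside the cube. *)
pose I (j : 'I_t) : set RT := if tnth s j < 1 / 2 then `[tnth s j, tnth s j + dl j[%classic
   else `[tnth s j - dl j, tnth s j[%classic.
have mI j : measurable (I j) by rewrite /I; case: ifP.
pose Box : set (t.-tuple RT) := [set x | forall j, I j (tnth x j)].
have mBox : measurable Box by exact: measurable_box.
have IP j (z : R) : I j z -> (0 <= z < 1) /\ `|z - tnth s j| <= dl j.
  have /andP[h1 h2] := sC j; rewrite /I; case: (ltP (tnth s j : R) (1 / 2)) => h; rewrite /= ?in_itv /= => /andP[z1 z2].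
    have := dl1 j; rewrite ler_norml; split; apply/andP; split; lra.
  have := dl1 j; rewrite ler_norml; split; apply/andP; split; lra.
have muI j : mu (I j) = (dl j)%:E.
  rewrite /I; case: ifP => _; rewrite lebesgue_measure_itv /= lte_fin.
    by rewrite ltrDl dl0 -EFinD addrAC subrr add0r.
  by rewrite gtrBl dl0 -EFinD opprB addrC subrK.
have vBox : lam t Box = v%:E.
  rewrite lebesgue_box //; under eq_bigr do rewrite muI.
  rewrite prodEFin; congr EFin.
  rewrite /dl; under eq_bigr do rewrite invfM mulrA.
  rewrite big_split /= prodr_const card_ord /v; congr (_ * _).
  rewrite prodfV; congr (_^-1); rewrite -expr_sum; congr (_ ^+ _).
  by rewrite big_tuple.
apply: le_trans (_ : \int[lam t]_(s in Box) F (assemble k i s d) <= _)%E; last first.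
  apply: ge0_subset_integral => //; first exact: measurable_funTS.
  by move=> x Bx j; have [] := IP j _ (Bx j).
apply: le_trans (_ : \int[lam t]_(s in Box) cst (l `^ (2 * u) * harmonic_sum n)%:E s <= _)%E.
  have -> : (\int[lam t]_(s in Box) cst (l `^ (2 * u) * harmonic_sum n)%:E s =
      (l `^ (2 * u) * harmonic_sum n)%:E * v%:E)%E.
    by rewrite integral_cst //; congr (_ * _)%E; exact: vBox.
  by rewrite -EFinM lee_fin mulrC.
apply: ge0_le_integral => //.
- by move=> x _; rewrite lee_fin mulr_ge0 // ltW.
- exact: measurable_funTS.
move=> x Bx; rewrite lee_fin; apply: (harmonic_moment_lower (alpha := assemble k i s d) nE u1 T1 TM a0 ab b1) big.
move=> m mM; apply: (@phase_assemble_dist R k t i s x d eta M m k0 (ltW eta0) mM) => j.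
by have [] := IP j _ (Bx j).
Qed.
End exceptional_set.

(** * Sums of powers and the measure of one exceptional set *)

Section elementary_bounds.
Variable R : realType.
Implicit Types (x y s c : R) (m n p : nat).

(** Both sides are separated by [exp (- s y)]. *)
Lemma powR1B_le s y : 0 <= s -> 0 < y < 1 -> (1 - y) `^ s <= (1 + s * y)^-1.
Proof.
move=> s0 /andP[y0 y1]; have y1' : 0 < 1 - y by lra.
have sy : 0 <= s * y by rewrite mulr_ge0 // ltW.
rewrite /powR gt_eqF //.
apply: le_trans (_ : expR (- (s * y)) <= _).
  by rewrite ler_expR -mulrN ler_wpM2l // le_ln1Dx //; lra.
by rewrite expRN lef_pV2 ?posrE ?expR_gt0 ?expR_ge1Dx //; lra.
Qed.

Lemma natr_predE m : m.+1%:R * (1 - m.+1%:R^-1) = m%:R :> R.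
Proof. by rewrite mulrBr mulr1 divff ?pnatr_eq0 // -natr1 addrK. Qed.

(** A telescoping form of the integral comparison. With [x = m + 2] and [y = 1 / x] it reduces to
    [1 + s y <= (1 - y) ^ (- s)]. *)
Lemma powR_neg_step m s : 0 < s -> 
  m.+2%:R `^ (- (1 + s)) <= s^-1 * (m.+1%:R `^ (- s) - m.+2%:R `^ (- s)) :> R.
Proof.
move=> s0; set x := m.+2%:R; have x1 : 1 < x by rewrite ltr1n.
have x0 : 0 < x by lra.
have y01 : 0 < x^-1 < 1 by rewrite invr_gt0 x0 invf_lt1.
have -> : m.+1%:R = x * (1 - x^-1) :> R by rewrite natr_predE.
have H := powR1B_le (ltW s0) y01.
have h1 : 0 < 1 - x^-1 by rewrite subr_gt0; case/andP: y01.
have h0 := ltW h1.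
rewrite powRM ?(ltW x0) // opprD powRD ?(gt_eqF x0) ?implybT // powR_inv1 ?(ltW x0) //.
have P := powR_gt0 (- s) x0.
have : 1 + s * x^-1 <= (1 - x^-1) `^ (- s).
  rewrite powRN -[leLHS]invrK lef_pV2 ?posrE ?powR_gt0 // invr_gt0.
  by rewrite ltr_pwDl // mulr_ge0 ?(ltW s0) //; case/andP: y01 => /ltW.
move: (x `^ (- s)) ((1 - x^-1) `^ (- s)) P => a b a0 hb.
have -> : s^-1 * (a * b - a) = a * (s^-1 * (b - 1)) by ring.
by rewrite [leLHS]mulrC ler_pM2l // [leRHS]mulrC ler_pdivlMr // lerBrDl [_^-1 * s]mulrC.
Qed.

Lemma sum_powR_neg_le n s : 0 < s ->
  \sum_(m < n) m.+1%:R `^ (- (1 + s)) <= 1 + s^-1 :> R.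
Proof.
move=> s0; have si : 0 < s^-1 by rewrite invr_gt0.
case: n => [|n]; first by rewrite big_ord0; lra.
apply: le_trans (_ : 1 + s^-1 * (1 - n.+1%:R `^ (- s)) <= _); last first.
  by rewrite lerD2l ler_piMr ?(ltW si) // gerBl powR_ge0.
elim: n => [|n IH]; first by rewrite big_ord1 !powR1 subrr mulr0 addr0.
by rewrite big_ord_recr /=; have := powR_neg_step n s0; lra.
Qed.

(** An arbitrarily small power is affordable in place of the logarithm. For [x = n + 1] and
    [y = 1 / x] the increment of the right side is at least [y], because [1 - (1 - y) ^ s >= s y /
    (1 + s y) >= s y / (1 + s)]. *)
Lemma harmonic_sum_le n s : 0 < s -> harmonic_sum R n <= (1 + s) / s * n%:R `^ s.
Proof.
move=> s0; elim: n => [|n IH].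
  by rewrite /harmonic_sum big_ord0 powR0 ?mulr0 // gt_eqF.
rewrite /harmonic_sum big_ord_recr /= -/(harmonic_sum R n).
apply: le_trans (lerD IH (lexx _)) _; rewrite -lerBrDl -mulrBr.
have [->|n0] := eqVneq n 0%N.
  rewrite powR0 ?gt_eqF // powR1 subr0 mulr1 invr1 ler_pdivlMr // mul1r; lra.
set x := n.+1%:R; have x1 : 1 < x by rewrite ltr1n; case: (n) n0.
have x0 : 0 < x by lra.
have y01 : 0 < x^-1 < 1 by rewrite invr_gt0 x0 invf_lt1.
have -> : n%:R = x * (1 - x^-1) :> R by rewrite natr_predE.
have h0 : 0 <= 1 - x^-1 by rewrite subr_ge0 ltW //; case/andP: y01.
rewrite powRM ?(ltW x0) //.
have H := powR1B_le (ltW s0) y01.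
have P : 1 <= x `^ s by rewrite -[leLHS](powRr0 x) ler_powR // ltW.
move: (x `^ s) ((1 - x^-1) `^ s) P H => a b a1 hb.
move: y01 hb => /andP[]; move: (x^-1) => y y0 y1 hb.
have sy : 0 < 1 + s * y by have := mulr_gt0 s0 y0; lra.
have e : 1 - (1 + s * y)^-1 = s * y / (1 + s * y) by field; rewrite gt_eqF.
have e2 : s * y / (1 + s) <= 1 - b.
  apply: le_trans (_ : 1 - (1 + s * y)^-1 <= _); last by lra.
  rewrite e ler_pM2l ?mulr_gt0 // lef_pV2 ?posrE //; last by lra.
  by rewrite lerD2l ler_piMr ?(ltW s0) // ltW.
have -> : y = (1 + s) / s * (s * y / (1 + s)) by field; rewrite !gt_eqF //; lra.
rewrite ler_wpM2l ?divr_ge0 ?(ltW s0) //; first by lra.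
apply: (le_trans e2); have -> : a - a * b = a * (1 - b) by ring.
rewrite ler_peMl //; apply: le_trans e2; rewrite divr_ge0 ?mulr_ge0 ?(ltW s0) ?(ltW y0) //; lra.
Qed.

(** The exponent collects [u + delta] from the moment, [t (1 - theta) + sg] from the volume of the
    box, and [2 u (delta - theta)] from the threshold [T / (8 L)]. *)
Lemma exceptional_bound (u delta theta C T L K : R) (M k t sg : nat) :
  (0 < M)%N -> (0 < k)%N -> 0 <= u -> T = M%:R `^ theta -> 0 < L -> L <= K * M%:R `^ delta -> 0 <= C ->
  (C * M%:R `^ (u + delta)) /
    ((T / (16 * M%:R) / k%:R) ^+ t / M%:R ^+ sg * (T / (8 * L)) `^ (2 * u)) <=
  C * (16 * k%:R) ^+ t * (8 * K) `^ (2 * u) *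
    M%:R `^ (u + delta + t%:R + sg%:R + 2 * u * delta - theta * (t%:R + 2 * u)).
Proof.
move=> M0 k0 u0 TE L0 LK C0; set X : R := M%:R in TE LK *.
have X0 : 0 < X by rewrite ltr0n.
have kR : 0 < k%:R :> R by rewrite ltr0n.
have T0 : 0 < T by rewrite TE powR_gt0.
have pD x y : X `^ x * X `^ y = X `^ (x + y) by rewrite powRD // (gt_eqF X0) implybT.
have P (z : R) : 0 < X `^ z by exact: powR_gt0.
have K0 : 0 < K by rewrite -(pmulr_lgt0 _ (P delta)); exact: lt_le_trans LK.
have l8 : 0 < T / (8 * L) by rewrite divr_gt0 // mulr_gt0.
have l8K : 0 < T / (8 * (K * X `^ delta)) by rewrite divr_gt0 // !mulr_gt0.
have v0 : 0 < (T / (16 * X) / k%:R) ^+ t / X ^+ sg.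
  by rewrite divr_gt0 ?exprn_gt0 // divr_gt0 // divr_gt0 // mulr_gt0.
rewrite ler_pdivrMr; last by rewrite mulr_gt0 // powR_gt0.
have lle : (T / (8 * (K * X `^ delta))) `^ (2 * u) <= (T / (8 * L)) `^ (2 * u).
  apply: ge0_ler_powR; [by rewrite mulr_ge0|by rewrite nnegrE ltW|by rewrite nnegrE ltW|].
  by rewrite (ler_pM2l T0) lef_pV2 ?posrE ?mulr_gt0 // ler_pM2l.
set E := _ - _; set v := (_ / _ : R) in v0 *.
have eqv : (16 * k%:R) ^+ t * v = X `^ ((theta - 1) * t%:R - sg%:R).
  rewrite /v mulrA -exprMn.
  have -> : 16 * k%:R * (T / (16 * X) / k%:R) = X `^ (theta - 1).
    rewrite powRD ?(gt_eqF X0) ?implybT // powR_inv1 ?(ltW X0) // -TE.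
    by field; rewrite !gt_eqF.
  by rewrite -[RHS]pD powRrM [X `^ (- _)]powRN !powR_mulrn ?powR_ge0 ?(ltW X0).
have eql : (8 * K) `^ (2 * u) * (T / (8 * (K * X `^ delta))) `^ (2 * u) = X `^ ((theta - delta) * (2 * u)).
  rewrite -powRM ?(ltW l8K) ?mulr_ge0 ?(ltW K0) // [RHS]powRrM; congr (_ `^ _).
  by rewrite -[RHS]pD powRN -TE; field; rewrite !gt_eqF.
have {eql} lower : X `^ ((theta - delta) * (2 * u)) <= (8 * K) `^ (2 * u) * (T / (8 * L)) `^ (2 * u).
  by rewrite -eql ler_wpM2l // powR_ge0.
have -> : C * (16 * k%:R) ^+ t * (8 * K) `^ (2 * u) * X `^ E * (v * (T / (8 * L)) `^ (2 * u)) =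
   C * (X `^ E * ((16 * k%:R) ^+ t * v) * ((8 * K) `^ (2 * u) * (T / (8 * L)) `^ (2 * u))) by ring.
rewrite ler_wpM2l // eqv pD.
apply: le_trans (ler_wpM2l (ltW (P _)) lower); rewrite pD le_eqVlt; apply/orP; left; apply/eqP.
by congr (_ `^ _); rewrite /E; ring.
Qed.
End elementary_bounds.

(** * Borel-Cantelli along powers *)

Section discrepancy.
Variable R : realType.
Notation RT := (measurableTypeR R).
Notation lam := (lebesgue_tuple R).
Implicit Types (k t p : nat) (a b theta N : R).

Lemma Zcount_mono k a b (alpha : k.-tuple R) N N' : N <= N' ->
  (Zcount a b alpha N <= Zcount a b alpha N')%N.
Proof.
move=> NN; have tr : (Num.truncn N <= Num.truncn N')%N by exact: le_truncn.
by rewrite /Zcount -(subnKC tr) iotaD count_cat leq_addr.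
Qed.

Lemma discrepancy_trivial k a b (alpha : k.-tuple R) N theta :
  0 <= a -> a < b -> b <= 1 -> 1 <= N -> 1 <= theta ->
  `|(Zcount a b alpha N)%:R - (b - a) * N| <= N `^ theta.
Proof.
move=> a0 ab b1 N1 th1; have N0 : 0 <= N by lra.
apply: le_trans (_ : N <= _); last by rewrite -{1}(powRr1 N0) ler_powR.
have ZN : (Zcount a b alpha N)%:R <= N.
  apply: le_trans (_ : (Num.truncn N)%:R <= _); last by have /andP[] := truncn_itv N0.
  by rewrite ler_nat -[leqRHS](size_iota 1) count_size.
have Z0 : 0 <= (Zcount a b alpha N)%:R :> R by [].
rewrite ler_norml; apply/andP; split; nra.
Qed.

Lemma natr_expB_le p (x : R) : 1 <= x ->
  (x + 1) ^+ p.+1 - x ^+ p.+1 <= p.+1%:R * 2 ^+ p * x ^+ p.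
Proof.
move=> x1; elim: p => [|p IH]; first by rewrite !expr1 !expr0; lra.
have x0 : 0 <= x by lra.
have h : (x + 1) ^+ p.+1 <= 2 ^+ p.+1 * x ^+ p.+1.
  by rewrite -exprMn ler_pXn2r ?nnegrE //; lra.
have -> : (x + 1) ^+ p.+2 - x ^+ p.+2 =
   x * ((x + 1) ^+ p.+1 - x ^+ p.+1) + (x + 1) ^+ p.+1 by rewrite !(exprS _ p.+1); ring.
apply: le_trans (lerD (ler_wpM2l x0 IH) h) _.
have -> : x * (p.+1%:R * 2 ^+ p * x ^+ p) = p.+1%:R * (2 ^+ p * x ^+ p.+1) by rewrite (exprS x); ring.
have P : 0 <= 2 ^+ p * x ^+ p.+1 :> R by rewrite mulr_ge0 ?exprn_ge0.
have n0 : 0 <= p.+1%:R :> R by [].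
rewrite -(natr1 p.+1) (exprS 2 p) -!mulrA.
move: (2 ^+ p * x ^+ p.+1) P => A A0; nra.
Qed.

(* Between consecutive p-th powers both sides of the count move by
   O(N ^ (1 - 1 / p)), which the hypothesis on [theta] makes admissible. *)
Lemma discrepancy_interpolation k a b (alpha : k.-tuple R) theta p m0 N :
  0 <= a -> a < b -> b <= 1 -> 0 <= theta <= 1 -> 1 - p.+1%:R^-1 <= theta ->
  (0 < m0)%N -> (forall m, (m0 <= m)%N ->
    `|(Zcount a b alpha (m ^ p.+1)%:R)%:R - (b - a) * (m ^ p.+1)%:R| <= (m ^ p.+1)%:R `^ theta) ->
  (m0 ^ p.+1)%:R <= N ->
  `|(Zcount a b alpha N)%:R - (b - a) * N| <= (2 ^+ p.+1 + p.+1%:R * 2 ^+ p) * N `^ theta.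
Proof.
move=> a0 ab b1 /andP[th0 th1] thp m00 H m0N.
have p0 : 0 < p.+1%:R :> R by rewrite ltr0n.
have N1 : 1 <= N by apply: le_trans m0N; rewrite ler1n expn_gt0 m00.
have N0 : 0 < N by lra.
(* With [q] the integer part of this root, [N] lies between the powers [q ^ p.+1] and
   [q.+1 ^ p.+1]. *)
pose r := N `^ p.+1%:R^-1.
have r0 : 0 <= r by exact: powR_ge0.
have rp : r ^+ p.+1 = N by rewrite -powR_mulrn // -powRrM mulVf ?gt_eqF // powRr1 // ltW.
have /andP[q1 q2] := truncn_itv r0.
set q := Num.truncn r in q1 q2.
have mq : (m0 <= q)%N.
  rewrite truncn_ge_nat // -(@ler_pXn2r _ p.+1) ?nnegrE // rp.
  by rewrite -natrX.
have q0 : (0 < q)%N by exact: leq_trans mq.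
have qN : (q ^ p.+1)%:R <= N by rewrite natrX -rp ler_pXn2r ?nnegrE.
have Nq : N <= (q.+1 ^ p.+1)%:R by rewrite natrX -rp ler_pXn2r ?nnegrE // ltW.
have qR : 1 <= q%:R :> R by rewrite ler1n.
have gap : (q.+1 ^ p.+1)%:R - (q ^ p.+1)%:R <= p.+1%:R * 2 ^+ p * N `^ theta.
  rewrite !natrX -natr1; apply: le_trans (natr_expB_le p qR) _.
  rewrite ler_wpM2l ?mulr_ge0 ?exprn_ge0 //.
  apply: le_trans (_ : r ^+ p <= _); first by rewrite lerXn2r ?nnegrE.
  rewrite -powR_mulrn // -powRrM ler_powR //; apply: le_trans thp.
  by rewrite -(natr1 p) le_eqVlt; apply/orP; left; apply/eqP; field; rewrite natr1 gt_eqF.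
have B1 : (q ^ p.+1)%:R `^ theta <= N `^ theta by apply: ge0_ler_powR; rewrite ?nnegrE ?(ltW N0).
have B2 : (q.+1 ^ p.+1)%:R `^ theta <= 2 ^+ p.+1 * N `^ theta.
  have h1 : (q.+1 ^ p.+1)%:R <= 2 ^+ p.+1 * N.
    apply: le_trans (_ : 2 ^+ p.+1 * q%:R ^+ p.+1 <= _); last by rewrite ler_wpM2l ?exprn_ge0 // -natrX.
    by rewrite natrX -exprMn lerXn2r ?nnegrE ?mulr_ge0 // -natr1; lra.
  apply: le_trans (_ : (2 ^+ p.+1 * N) `^ theta <= _).
    by apply: ge0_ler_powR; rewrite ?nnegrE ?mulr_ge0 ?exprn_ge0 // ltW.
  rewrite powRM ?exprn_ge0 ?(ltW N0) // ler_wpM2r ?powR_ge0 //.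
  by rewrite -[leRHS](@powRr1 _ (2 ^+ p.+1)) ?exprn_ge0 // ler_powR // exprn_ege1 // ler1n.
have := H _ mq; have := H _ (leqW mq); rewrite !ler_norml => /andP[_ h2] /andP[h1 _].
have Z1 : (Zcount a b alpha (q ^ p.+1)%:R)%:R <= (Zcount a b alpha N)%:R :> R by rewrite ler_nat Zcount_mono.
have Z2 : (Zcount a b alpha N)%:R <= (Zcount a b alpha (q.+1 ^ p.+1)%:R)%:R :> R by rewrite ler_nat Zcount_mono.
have two : 1 <= 2 ^+ p.+1 :> R by rewrite exprn_ege1 // ler1n.
have P := powR_ge0 N theta.
have B3 : N `^ theta <= 2 ^+ p.+1 * N `^ theta by rewrite ler_peMl.
rewrite mulrDl; move: gap B1 B2 B3 h1 h2 Z1 Z2 qN Nq.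
move: (2 ^+ p.+1 * N `^ theta) => A1; move: (p.+1%:R * 2 ^+ p * N `^ theta) => A2.
move: ((q ^ p.+1)%:R `^ theta) ((q.+1 ^ p.+1)%:R `^ theta) (N `^ theta) => A3 A4 A5.
move: ((Zcount a b alpha N)%:R : R) => z.
move: ((Zcount a b alpha (q ^ p.+1)%:R)%:R : R) ((Zcount a b alpha (q.+1 ^ p.+1)%:R)%:R : R) => z1 z2.
move: ((q ^ p.+1)%:R : R) ((q.+1 ^ p.+1)%:R : R) => M1 M2.
move=> gap B1 B2 B3 h1 h2 Z1 Z2 qN Nq; apply/andP; split; nra.
Qed.

(** At [eps = 0] the two sides agree, and this equation is what determines [nu]. The terms in [eps]
    add [(1 - t) eps] on the left and cancel on the right. *)
Lemma nu_exponent t (i : t.-tuple nat) u eps (sg := (\sum_(j <- i) j)%N) : 1 <= u -> (0 < t)%N ->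
  0 < eps ->
  u + eps + t%:R + sg%:R + 2 * u * eps - (1 / 2 + nu i u + eps) * (t%:R + 2 * u)
    <= 2 * (1 / 2 + nu i u + eps) - 2 - 2 * eps :> R.
Proof.
move=> u1 t0 e0; have tR : 1 <= t%:R :> R by rewrite ler1n.
have D : 0 < 4 * u + 2 * t%:R + 4 by lra.
have E : nu i u * (4 * u + 2 * t%:R + 4) = t%:R + 2 + 2 * sg%:R.
  by rewrite /nu divfK // gt_eqF.
move: (nu i u) E => v E; nra.
Qed.

(** Borel-Cantelli along the powers [M = m ^ p.+1]. The lower bound on [p.+1 * (1 - theta)] makes
    the measures of the exceptional sets summable over [m]. *)
Lemma ae_discrepancy k u (hu : 1 <= u <= k%:R * (k%:R + 1) / 2) (hMC : MC k u)
    t (i : t.-tuple nat) eps p :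
  (1 <= t <= k)%N -> sorted ltn i -> all (fun j => (1 <= j <= k)%N) i -> 0 < eps ->
  let theta := 1 / 2 + nu i u + eps in
  0 <= theta < 1 -> 1 / 2 <= p.+1%:R * (1 - theta) ->
  exists2 S : set ((k - t).-tuple RT), (lam (k - t)).-negligible S &
    forall d, unit_cube R (k - t) d -> ~ S d -> exists2 m0, (0 < m0)%N & forall m, (m0 <= m)%N ->
    forall s a b, unit_cube R t s -> 0 <= a -> a < b -> b <= 1 ->
    `|(Zcount a b (assemble k i s d) (m ^ p.+1)%:R)%:R - (b - a) * (m ^ p.+1)%:R|
      <= (m ^ p.+1)%:R `^ theta.
Proof.
move=> /andP[t0 tk] si ri e0 theta /andP[th0 th1] hp.
have /andP[u1 _] := hu.
have k0 : (0 < k)%N by exact: leq_trans tk.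
have [C C0 HC] := MC_moment hu hMC e0.
(* The number of frequencies is a cube, [(16 M) ^ 3], so the exponent [eps / 3] turns the harmonic
   sum into a multiple of [M ^ eps]. *)
pose e3 := eps / 3; have e30 : 0 < e3 by rewrite divr_gt0.
pose K : R := (1 + e3) / e3 * 16 `^ eps.
pose M m := (m.+1 ^ p.+1)%N.
have M0 m : (0 < M m)%N by rewrite expn_gt0.
have MR m : 1 <= (M m)%:R :> R by rewrite ler1n.
pose T m : R := (M m)%:R `^ theta.
have T1 m : 1 <= T m by rewrite /T -[leLHS](powRr0 (M m)%:R) ler_powR.
have TM m : T m <= (M m)%:R by rewrite /T -[leRHS]powRr1 // ler_powR // ltW.
pose n m := ((16 * M m) ^ 3)%N.
have n0 m : (0 < n m)%N by rewrite expn_gt0 muln_gt0 M0.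
have LK m : harmonic_sum R (n m) <= K * (M m)%:R `^ eps.
  apply: le_trans (harmonic_sum_le _ e30) _; rewrite /K -[leRHS]mulrA.
  have c0 : 0 <= (1 + e3) / e3 by rewrite divr_ge0 ?(ltW e30) //; lra.
  rewrite (ler_wpM2l c0) //.
  by rewrite /n natrX natrM -powR_mulrn ?mulr_ge0 // -powRrM /e3 mulrCA divff ?mulr1 // powRM.
have cover m := exceptional_set_cover k0 tk si ri (erefl (n m)) u1 (T1 m) (TM m)
   (fun h h0 => HC (M m) h (M0 m) h0).
have [A HA] := choice cover.
pose B : R := C * (16 * k%:R) ^+ t * (8 * K) `^ (2 * u).
have B0 : 0 <= B by rewrite !mulr_ge0 ?exprn_ge0 ?mulr_ge0 ?powR_ge0.
have muA m : (lam (k - t) (A m) <= (B * m.+1%:R `^ (- (1 + 2 * eps)))%:E)%E.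
  have [_ h _] := HA m; apply: le_trans h _; rewrite lee_fin.
  have := exceptional_bound (u := u) (T := T m) t (\sum_(j <- i) j)%N (M0 m) k0 (le_trans ler01 u1) erefl
    (harmonic_sum_gt0 R (n0 m)) (LK m) C0.
  move=> /le_trans; apply; rewrite -/B ler_wpM2l //.
  rewrite /M natrX -powR_mulrn // -powRrM ler_powR ?ler1n //.
  (* The exponent of [M] is at most [- 2 (1 - theta) - 2 eps]. Multiplied by [p.+1], its first part
     is at most -1 by [hp], and the second at most [- 2 eps]. *)
  have := nu_exponent i u1 t0 e0; rewrite -/theta; set E := (_ - _ * _) => hE.
  have p0 : 0 <= p.+1%:R :> R by [].
  apply: le_trans (ler_wpM2l p0 hE) _.
  have p1 : 1 <= p.+1%:R :> R by rewrite ler1n.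
  by nra.
have mA m : measurable (A m) by have [] := HA m.
exists (lim_sup_set A).
  have mS : measurable (lim_sup_set A).
    by apply: bigcap_measurable => // j _; apply: bigcup_measurable => *.
  exists (lim_sup_set A); split => //; apply: lim_sup_set_cvg0 => //.
  apply: (@le_lt_trans _ _ (B * (1 + (2 * eps)^-1))%:E); last exact: ltry.
  apply: lime_le; first by apply: is_cvg_nneseries => *; exact: measure_ge0.
  apply: nearW => j.
  apply: le_trans (_ : (\sum_(0 <= m < j) (B * m.+1%:R `^ (- (1 + 2 * eps)))%:E <= _)%E).
    by apply: lee_sum => m _; exact: muA.
  rewrite sumEFin lee_fin -mulr_sumr ler_wpM2l // big_mkord.
  by apply: sum_powR_neg_le; rewrite mulr_gt0.
move=> d dC nS; have [j hj] : exists j, forall m, (j <= m)%N -> ~ A m d.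
  apply/not_existsP => h; apply: nS => j _; have /existsNP[m /not_implyP[jm /contrapT Am]] := h j.
  by exists m.
(* The set [A m] concerns the power of [m.+1], hence the threshold [j.+1]. *)
exists j.+1 => // m jm s a b sC a0 ab b1; rewrite leNgt; apply/negP => big.
have [m' mE] : exists m', m = m'.+1 by exists m.-1; rewrite prednK // (leq_trans _ jm).
subst m; have [_ _ /(_ d s a b dC sC a0 ab b1 big)] := HA m'.
exact: hj.
Qed.
End discrepancy.

(** * One exceptional set for all exponents *)

Theorem theorem1p4 (R : realType) (k : nat) (hk : (3 <= k)%N)
  (u : R) (hu : 1 <= u <= k%:R * (k%:R + 1) / 2) (hMC : MC k u)
  (t : nat) (ht : (1 <= t <= k)%N)
  (i : t.-tuple nat) (hi_sorted : sorted ltn i)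
  (hi_range : all (fun j => (1 <= j <= k)%N) i) :
  exists B : set ((k - t).-tuple (measurableTypeR R)),
    [/\ B `<=` unit_cube R (k - t),
        (lebesgue_tuple R (k - t)).-negligible (unit_cube R (k - t) `\` B) &
        forall adag : (k - t).-tuple R, B adag ->
        forall eps : R, 0 < eps ->
        exists N0 : R, forall N : R, N0 <= N ->
        forall astar : t.-tuple R, unit_cube R t astar ->
        forall a b : R, 0 <= a -> a < b -> b <= 1 ->
          `| (Zcount a b (assemble k i astar adag) N)%:R - (b - a) * N |
            <= N `^ (1 / 2 + nu i u + eps)].
Proof.
have /andP[u1 _] := hu.
have nu0 : 0 <= nu i u by rewrite /nu divr_ge0 // !addr_ge0 ?mulr_ge0 //; lra.
(* Countably many values of [eps] tending to 0 suffice, so that the union of the exceptional sets is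
   still negligible. *)
pose eps_ (j : nat) : R := j.+1%:R^-1.
pose theta j := 1 / 2 + nu i u + eps_ j.
have e0 j : 0 < eps_ j by rewrite invr_gt0.
(* Let [q = (p j).+1] be the integer part of [1 / (1 - theta j)]. From [q <= 1 / (1 - theta j)]
   follows the density needed for interpolation, and from [q + 1 > 1 / (1 - theta j)] with [q >= 1]
   the bound [q (1 - theta j) >= 1 / 2] needed for summability. *)
pose p j := (Num.truncn ((1 - theta j)^-1)).-1.
have pP j : theta j < 1 -> 1 / 2 <= (p j).+1%:R * (1 - theta j) /\ 1 - (p j).+1%:R^-1 <= theta j.
  move=> th1; have th0 : 0 < 1 - theta j by lra.
  have thp : 0 < theta j by have := e0 j; rewrite /theta; lra.
  have inv1 : 1 < (1 - theta j)^-1 by rewrite invf_gt1 //; lra.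
  have /andP[q1 q2] := truncn_itv (ltW (lt_trans ltr01 inv1)).
  have qpos : (0 < Num.truncn (1 - theta j)^-1)%N by rewrite truncn_gt0 ltW.
  have qE : (p j).+1 = Num.truncn (1 - theta j)^-1 by rewrite /p prednK.
  rewrite qE; move: q1 q2; rewrite -natr1; have : 1 <= (Num.truncn (1 - theta j)^-1)%:R :> R by rewrite ler1n.
  move: (Num.truncn _)%:R => q qge q1 q2; split.
    have : (1 - theta j)^-1 * (1 - theta j) < (q + 1) * (1 - theta j) by rewrite ltr_pM2r.
    by rewrite mulVf ?gt_eqF // => h; nra.
  rewrite lerBlDr -lerBlDl -[leLHS]invrK lef_pV2 ?posrE ?invr_gt0 //; lra.
have step j : exists S : set ((k - t).-tuple (measurableTypeR R)),
  (lebesgue_tuple R (k - t)).-negligible S /\ (theta j < 1 ->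
    forall d, unit_cube R (k - t) d -> ~ S d -> exists2 m0, (0 < m0)%N & forall m, (m0 <= m)%N ->
    forall s a b, unit_cube R t s -> 0 <= a -> a < b -> b <= 1 ->
    `|(Zcount a b (assemble k i s d) (m ^ (p j).+1)%:R)%:R - (b - a) * (m ^ (p j).+1)%:R|
      <= (m ^ (p j).+1)%:R `^ theta j).
  have [th1|th1] := ltP (theta j) 1; last by exists set0; split; [exact: negligible_set0|].
  have [|S nS HS] := ae_discrepancy hu hMC ht hi_sorted hi_range (e0 j) _ (pP j th1).1.
    by rewrite -/(theta j) th1 andbT; have := e0 j; rewrite /theta; lra.
  by exists S.
have [S HS] := choice step.
exists (unit_cube R (k - t) `\` \bigcup_j S j); split.
- by move=> x [].
- apply: negligibleS (negligible_bigcup (fun j => (HS j).1)).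
  by move=> x [xC]; rewrite setDE => /not_andP[//|/contrapT].
move=> d [dC dS] eps eps0.
have [th1|th1] := leP 1 (1 / 2 + nu i u + eps).
  by exists 1 => N N1 s sC a b a0 ab b1; exact: discrepancy_trivial.
(* Half of [eps] is kept in reserve to absorb the constant of the interpolation. *)
have [j hj] : exists j, eps_ j < eps / 2.
  exists (Num.truncn (2 / eps)); rewrite /eps_ invf_plt ?posrE ?divr_gt0 //.
  by rewrite invf_div truncnS_gt.
have thj : theta j < 1 by rewrite /theta; lra.
have [_ /(_ thj d dC)[|m0 m00 Hm]] := HS j; first by move=> Sd; apply: dS; exists j.
pose c : R := 2 ^+ (p j).+1 + (p j).+1%:R * 2 ^+ p j.
have c0 : 0 < c by rewrite ltr_pwDl ?exprn_gt0 // mulr_ge0 ?exprn_ge0.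
(* The last entry ensures [c <= N ^ (eps / 2)]; the middle one puts [N] in the range where the bound
   at the powers holds. *)
exists (Num.max 1 (Num.max (m0 ^ (p j).+1)%:R (c `^ (2 / eps)))) => N.
rewrite !ge_max => /and3P[N1 Nm Nc] s sC a b a0 ab b1.
have thb : 0 <= theta j <= 1 by rewrite (ltW thj) andbT /theta; have := e0 j; lra.
have := discrepancy_interpolation a0 ab b1 thb (pP j thj).2 m00 (fun m mm => Hm m mm s a b sC a0 ab b1) Nm.
move=> /le_trans; apply; rewrite -/c.
have N0 : 0 < N by lra.
apply: le_trans (_ : N `^ (eps / 2) * N `^ theta j <= _).
  rewrite ler_wpM2r ?powR_ge0 //.
  have -> : c = (c `^ (2 / eps)) `^ (eps / 2).
    by rewrite -powRrM mulrA divfK ?gt_eqF // divff // powRr1 // ltW.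
  by apply: ge0_ler_powR; rewrite ?nnegrE ?powR_ge0 ?divr_ge0 ?(ltW N0) ?(ltW eps0).
by rewrite -powRD ?(gt_eqF N0) ?implybT // ler_powR // /theta; lra.
Qed.
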